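(* If two exterior splashes of $\ell_\infty$ in $\mathrm{PG}(2,q^3)$ meet in $2q+2$ points, then these points correspond to (that is, form) two disjoint order-$q$-sublines, one from each family.
   Context: $q$ is a prime power and $\ell_\infty$ is a fixed line of $\mathrm{PG}(2,q^3)$. An order-$q$-subplane of $\mathrm{PG}(2,q^3)$ is an image of $\mathrm{PG}(2,q)$ under $\mathrm{PGL}(3,q^3)$; it is exterior if it has no point on $\ell_\infty$. The exterior splash of an exterior order-$q$-subplane $\pi$ is the set of $q^2+q+1$ points of $\ell_\infty$ lying on extended lines of $\pi$; an exterior splash of $\ell_\infty$ is any set arising in this way. An order-$q$-subline of $\ell_\infty$ is a set of $q+1$ points of $\ell_\infty$ projectively equivalent to $\mathrm{PG}(1,q)\subset\mathrm{PG}(1,q^3)$. Families. An exterior splash $\mathbb S$ contains $2(q^2+q+1)$ order-$q$-sublines that lie in two distinct families of size $q^2+q+1$, described as follows. Let $\pi$ be an exterior order-$q$-subplane with exterior splash $\mathbb S$, and let $m,n$ be the two conjugates of $\ell_\infty$ with respect to $\pi$ (if $\pi=\phi(\mathrm{PG}(2,q))$, conjugation is $\phi\circ\mathrm{Frob}_q\circ\phi^{-1}$). One family consists of the sublines obtained by intersecting $\ell_\infty$ with the $q+1$ (extended) lines of $\pi$ through a point $P$, as $P$ ranges over the points of $\pi$. The other family consists of the sublines obtained by intersecting $\ell_\infty$ with the $q+1$ (extended) lines of a special dual conic of $\pi$, that is, a dual conic of $\pi$ whose extension to $\mathrm{PG}(2,q^3)$ contains the three lines $\ell_\infty,m,n$.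 The pair of families does not depend on the choice of $\pi$ (which of the two families arises from points does). Two distinct sublines in the same family meet in exactly one point; sublines in different families meet in $0$, $1$ or $2$ points. In the claim, ''one from each family'' refers to the two families of order-$q$-sublines of a splash, for each of the two splashes. *)

(* Defs.v *)
From mathcomp Require Import all_boot all_order all_algebra.

Set Implicit Arguments.
Unset Strict Implicit.
Unset Printing Implicit Defensive.

Import GRing.Theory.
Local Open Scope ring_scope.

(* A projective subspace of PG(2, F) is a row space in F^3, represented by its
   canonical generator: a matrix U : 'M[F]_3 with <<U>>%MS = U, so that equal
   subspaces are equal matrices and incidence is (P <= l)%MS. *)
Definition PGpoints (F : finFieldType) : {set 'M[F]_3} :=
  [set P | (\rank P == 1%N) && (<<P>>%MS == P)].

Definition PGlines (F : finFieldType) : {set 'M[F]_3} :=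
  [set l | (\rank l == 2%N) && (<<l>>%MS == l)].

(* The line with dual coordinates u, that is, {x | x *m u = 0}. *)
Definition line_of (F : finFieldType) (u : 'cV[F]_3) : 'M[F]_3 :=
  <<kermx u>>%MS.

(* When #|F| = q ^ 3 with q a prime power, these are the elements of the
   subfield of order q. *)
Definition GFq (F : finFieldType) (q : nat) : {pred F} :=
  [pred x | x ^+ q == x].

(* The image of PG(2, q) under the projectivity x |-> x *m A, for
   A \in unitmx. *)
Definition subplane (F : finFieldType) (q : nat) (A : 'M[F]_3) :
    {set 'M[F]_3} :=
  [set <<v *m A>>%MS | v : 'rV[F]_3 & (v \is a mxOver (GFq q)) && (v != 0)].

Definition extended_lines (F : finFieldType) (pi : {set 'M[F]_3}) :
    {set 'M[F]_3} :=
  [set l in PGlines F | (1 < #|[set P in pi | (P <= l)%MS]|)%N].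

Definition exterior (F : finFieldType) (l : 'M[F]_3) (pi : {set 'M[F]_3}) :
    bool :=
  [forall P in pi, ~~ (P <= l)%MS].

Definition splash (F : finFieldType) (l : 'M[F]_3) (pi : {set 'M[F]_3}) :
    {set 'M[F]_3} :=
  [set P in PGpoints F |
    (P <= l)%MS && [exists m in extended_lines pi, (P <= m)%MS]].

Definition exterior_splash (F : finFieldType) (q : nat) (l : 'M[F]_3)
    (S : {set 'M[F]_3}) : Prop :=
  exists A : 'M[F]_3,
    [/\ A \in unitmx, exterior l (subplane q A) & S = splash l (subplane q A)].

(* The rows of B are a basis of l, so v |-> v *m B is a projectivity from
   PG(1, F) to l. *)
Definition subline (F : finFieldType) (q : nat) (l : 'M[F]_3)
    (b : {set 'M[F]_3}) : Prop :=
  exists B : 'M[F]_(2, 3),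
    [/\ row_free B, (B == l)%MS &
      b = [set <<v *m B>>%MS | v : 'rV[F]_2 &
             (v \is a mxOver (GFq q)) && (v != 0)]].

Definition section (F : finFieldType) (l : 'M[F]_3) (ms : {set 'M[F]_3}) :
    {set 'M[F]_3} :=
  [set <<m :&: l>>%MS | m in ms].

Definition point_family (F : finFieldType) (q : nat) (l A : 'M[F]_3) :
    {set {set 'M[F]_3}} :=
  [set section l [set m in extended_lines (subplane q A) | (P <= m)%MS]
    | P in subplane q A].

(* The collineation phi o Frob_q o phi^-1, with phi : x |-> x *m A. *)
Definition conjugate (F : finFieldType) (q : nat) (A l : 'M[F]_3) : 'M[F]_3 :=
  <<map_mx (fun x => x ^+ q) (l *m invmx A) *m A>>%MS.

(* As C ranges over all matrices, this ranges over all quadratic forms, in any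
   characteristic; C is not determined by its form. *)
Definition qform (F : finFieldType) (C : 'M[F]_3) (u : 'cV[F]_3) : F :=
  (u^T *m C *m u) 0 0.

(* C is a quadratic form over GF(q) without singular point: no nonzero w has
   both qform C w = 0 and trivial polar form qform C (u + w) - qform C u -
   qform C w. *)
Definition nonsingular_form (F : finFieldType) (q : nat) (C : 'M[F]_3) : bool :=
  (C \is a mxOver (GFq q)) &&
  [forall w : 'cV[F]_3,
    (w \is a mxOver (GFq q)) && (w != 0) && (qform C w == 0) ==>
    [exists u : 'cV[F]_3, (u \is a mxOver (GFq q)) &&
       (qform C (u + w) != qform C u + qform C w)]].

(* The map x |-> x *m A sends the line with dual coordinates u to the line with
   dual coordinates invmx A *m u. *)
Definition dual_conic (F : finFieldType) (q : nat) (A C : 'M[F]_3) :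
    {set 'M[F]_3} :=
  [set line_of (invmx A *m u) | u : 'cV[F]_3 &
    [&& u \is a mxOver (GFq q), u != 0 & qform C u == 0]].

Definition extended_dual_conic (F : finFieldType) (A C : 'M[F]_3) :
    {set 'M[F]_3} :=
  [set line_of (invmx A *m u) | u : 'cV[F]_3 & (u != 0) && (qform C u == 0)].

Definition special (F : finFieldType) (q : nat) (l A C : 'M[F]_3) : bool :=
  [&& nonsingular_form q C,
      l \in extended_dual_conic A C,
      conjugate q A l \in extended_dual_conic A C &
      conjugate q A (conjugate q A l) \in extended_dual_conic A C].

Definition conic_family (F : finFieldType) (q : nat) (l A : 'M[F]_3) :
    {set {set 'M[F]_3}} :=
  [set section l (dual_conic q A C) | C : 'M[F]_3 & special q l A C].

(* FP and FC are the two families of sublines of the splash S, as computed from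
   some exterior subplane whose splash is S. *)
Definition splash_families (F : finFieldType) (q : nat) (l : 'M[F]_3)
    (S : {set 'M[F]_3}) (FP FC : {set {set 'M[F]_3}}) : Prop :=
  exists A : 'M[F]_3,
    [/\ A \in unitmx, exterior l (subplane q A), S = splash l (subplane q A),
        FP = point_family q l A & FC = conic_family q l A].

Definition one_from_each (F : finFieldType) (FP FC : {set {set 'M[F]_3}})
    (b c : {set 'M[F]_3}) : bool :=
  (b \in FP) && (c \in FC) || (b \in FC) && (c \in FP).

(* Main.v *)
(* Conjugating a subplane pi of order q to its Moore coordinates (x, x^q, x^(q^2))
   turns the exterior line l into the line X_0 = 0, its two conjugates into X_1 = 0
   and X_2 = 0, and the lines of pi into tr(y X) = 0. In a suitable basis of l the
   splash becomes {(x^q : x)}, that is, the elements of norm 1; the sublines coming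
   from points are the images of the planes tr(a x) = 0, and those coming from special
   dual conics are the images of the cones tr(e / x) = 0.

   For a second splash with basis related by a matrix ((a, c), (b, d)), the point x lies
   on both splashes iff N(a x^q + b x) = N(c x^q + d x), which is a cubic curve in the
   variable x in PG(2, q). Counting on the lines through a point of the curve shows that
   a cubic with 2q + 2 points contains a line: otherwise every line through a point u
   meets the cubic in the maximal number of points, and the tangent at u, which meets
   it in exactly one further point w, would also be the tangent at w. The shape of the
   equation forces the cubic to be N(x) tr(al x) tr(e / x), which gives the two sublines
   for the first splash. On the plane tr(al x) = 0 the two norms agree as products
   of three linear forms, so by unique factorization c x^q + d x is proportional to
   a conjugate of a x^q + b x; this exhibits the same subline in one of the families of
   the second splash. Two sublines of one family meet, so both families occur. *)

From HB Require Import structures.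
Require Import Defs.
From mathcomp Require Import all_boot all_order all_algebra perm finfield.
From mathcomp Require Import ring zify.

Set Implicit Arguments.
Unset Strict Implicit.
Unset Printing Implicit Defensive.

Import GRing.Theory.
Local Open Scope ring_scope.

(** * Counting by fibres, and the Frobenius map as a ring morphism *)

Lemma card_fibers_le (T U : finType) (f : T -> U) (A : {set T}) (m : nat) :
  (forall y, #|[set x in A | f x == y]| <= m)%N -> (#|A| <= #|f @: A| * m)%N.
Proof.
move=> hm; rewrite -sum1_card (partition_big_imset f) /= -sum_nat_const.
apply: leq_sum => y _; apply: leq_trans (hm y).
by rewrite -sum1_card; apply/eq_leq/eq_bigl => x; rewrite inE.
Qed.

Lemma card_fibers (T U : finType) (f : T -> U) (A : {set T}) (m : nat) :
  (forall x, x \in A -> #|[set z in A | f z == f x]| = m) ->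
  #|A| = (#|f @: A| * m)%N.
Proof.
move=> hm; rewrite -sum1_card (partition_big_imset f) /= -sum_nat_const.
apply: eq_bigr => _ /imsetP[x xA ->]; rewrite -(hm x xA) -sum1_card.
by apply: eq_bigl => z; rewrite inE.
Qed.

Lemma card_roots_lt (F : finFieldType) (p : {poly F}) (A : {set F}) :
  p != 0 -> {in A, forall x, root p x} -> (#|A| < size p)%N.
Proof.
move=> p0 hA; rewrite cardE; apply: max_poly_roots => //.
  by apply/allP => x; rewrite mem_enum => /hA.
by rewrite enum_uniq.
Qed.

Lemma exists_frobenius (F : finFieldType) (q n : nat) :
    (exists p k : nat, [/\ prime p, 0 < k & q = p ^ k]%N) -> #|F| = (q ^ n)%N ->
  exists phi : {rmorphism F -> F}, forall x, phi x = x ^+ q.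
Proof.
move=> [p [k [p_pr k0 ->]]]; rewrite -expnM => /card_finPcharP-/(_ p_pr) pF.
have fD : zmod_morphism (fun x : F => x ^+ (p ^ k)).
  move=> x y; have pk : [pchar F].-nat (p ^ k)%N.
    by rewrite pnatX (eq_pnat _ (pcharf_eq pF)) pnat_id.
  by apply/eqP; rewrite eq_sym subr_eq -exprDn_pchar // subrK.
have fM : monoid_morphism (fun x : F => x ^+ (p ^ k)).
  by split=> [|x y]; rewrite ?expr1n ?exprMn.
pose add := GRing.isZmodMorphism.Build F F _ fD.
pose mul := GRing.isMonoidMorphism.Build F F _ fM.
by exists (HB.pack_for {rmorphism F -> F} (fun x : F => x ^+ (p ^ k)) add mul).
Qed.

(** * Trace, norm and wedge in a cubic extension *)

Section CubicExtension.

Context (F : finFieldType) (q : nat) (phi : {rmorphism F -> F}).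
Context (q_gt1 : (1 < q)%N) (cardF : #|F| = (q ^ 3)%N).
Context (phiE : forall x, phi x = x ^+ q).

Implicit Types (x y z s t : F).

Definition tr x := x + phi x + phi (phi x).
Definition nrm x := x * phi x * phi (phi x).

(* For y != 0, this vanishes iff x / y lies in the subfield of order q. *)
Definition wedge x y := x * phi y - phi x * y.

Lemma phi3 x : phi (phi (phi x)) = x.
Proof. by rewrite !phiE -!exprM -[RHS]expf_card cardF !expnS muln1 mulnA. Qed.

Lemma phi_tr x : phi (tr x) = tr x.
Proof. by rewrite /tr !rmorphD /= phi3; ring. Qed.

Lemma trD x y : tr (x + y) = tr x + tr y.
Proof. by rewrite /tr !rmorphD /=; ring. Qed.

Lemma tr_phi x : tr (phi x) = tr x.
Proof. by rewrite /tr phi3; ring. Qed.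

Lemma tr_fixM s x : phi s = s -> tr (s * x) = s * tr x.
Proof. by move=> hs; rewrite /tr !rmorphM /= !hs; ring. Qed.

Lemma nrm_eq0 x : (nrm x == 0) = (x == 0).
Proof. by rewrite /nrm !mulf_eq0 !fmorph_eq0 !orbb. Qed.

Lemma nrmM x y : nrm (x * y) = nrm x * nrm y.
Proof. by rewrite /nrm !rmorphM /=; ring. Qed.

Lemma nrm_phi x : nrm (phi x) = nrm x.
Proof. by rewrite /nrm phi3; ring. Qed.

Lemma wedge_eq0 x y : y != 0 -> wedge x y = 0 -> phi (x / y) = x / y.
Proof.
move=> y0 /eqP; rewrite subr_eq0 => /eqP e; rewrite rmorphM fmorphV.
by apply/eqP; rewrite eqr_div ?fmorph_eq0 // -e.
Qed.

Lemma wedge_neq0 x y : wedge x y != 0 -> (x != 0) * (y != 0).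
Proof.
move=> h; split; apply: contra_neq h => ->; rewrite /wedge rmorph0; ring.
Qed.

Definition fixed : {set F} := [set s | phi s == s].
(** For [a != 0] this is a plane of [F] over the subfield, hence a line of PG(2, q); [ker_tr 0] is
    all of [F]. *)
Definition ker_tr a : {set F} := [set x | tr (a * x) == 0].

Let q_gt0 : (0 < q)%N. Proof. exact: ltnW. Qed.
Let ltqq2 : (q < q ^ 2)%N. Proof. by rewrite -{1}(expn1 q) ltn_exp2l. Qed.
Let ltq2F : (q ^ 2 < #|F|)%N. Proof. by rewrite cardF ltn_exp2l. Qed.

Lemma size_linearized (a b c : F) : a != 0 ->
  size (a *: 'X^(q ^ 2) + b *: 'X^q + c *: 'X) = (q ^ 2).+1.
Proof.
move=> a0; have sX d k : (size (d *: 'X^k : {poly F}) <= k.+1)%N.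
  by apply: leq_trans (size_scale_leq _ _) _; rewrite size_polyXn.
rewrite -addrA size_polyDl size_scale // size_polyXn //.
apply: leq_ltn_trans (size_polyD _ _) _; rewrite gtn_max.
apply/andP; split; first exact: leq_ltn_trans (sX b q) _.
have := sX c 1%N; rewrite expr1 => /leq_ltn_trans; apply.
by rewrite ltnS (ltn_trans q_gt1).
Qed.

Lemma card_fixed_le : (#|fixed| <= q)%N.
Proof.
have sz : size ('X^q - 'X : {poly F}) = q.+1.
  by rewrite size_polyDl size_polyXn // size_polyN size_polyX.
rewrite -ltnS -sz; apply: card_roots_lt => [|x].
  by rewrite -size_poly_eq0 sz.
by rewrite inE phiE /root !hornerE => /eqP->; rewrite subrr.
Qed.

Lemma card_ker_tr_le a : a != 0 -> (#|ker_tr a| <= q ^ 2)%N.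
Proof.
move=> a0; have pa0 : phi (phi a) != 0 by rewrite !fmorph_eq0.
rewrite -ltnS -(size_linearized (phi a) a pa0); apply: card_roots_lt.
  by rewrite -size_poly_eq0 size_linearized.
move=> x; rewrite inE /root /tr !rmorphM /= => /eqP <-; rewrite !hornerE.
by rewrite exprM -!phiE; apply/eqP; ring.
Qed.

(** The map [k |-> phi k - k] sends [F] into [ker_tr 1] with fibres no larger than [fixed]. Hence
    q^3 <= #|ker_tr 1| * #|fixed|, and the upper bounds q^2 and q on the factors are attained. *)
Lemma card_fixed_ker_tr1 : #|fixed| = q /\ #|ker_tr 1| = (q ^ 2)%N.
Proof.
pose f k := phi k - k; pose K := f @: [set: F].
have sK : K \subset ker_tr 1.
  apply/subsetP => _ /imsetP[k _ ->]; rewrite inE mul1r /f /tr !rmorphB /= phi3.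
  by apply/eqP; ring.
have h1 := card_ker_tr_le (oner_neq0 F); have h2 := card_fixed_le.
have h3 := subset_leq_card sK.
have : (#|[set: F]| <= #|K| * #|fixed|)%N.
  apply: card_fibers_le => y; have [->|[z]] := set_0Vmem [set x in setT | f x == y].
    by rewrite cards0.
  rewrite !inE /= => /eqP fz.
  rewrite -(card_imset _ (addIr (- z))); apply/subset_leq_card/subsetP => _ /imsetP[x + ->].
  rewrite !inE /= -fz /f => /eqP e; rewrite rmorphB /=.
  by apply/eqP; rewrite -[phi x](subrK x) e; ring.
rewrite cardsT cardF expnSr => h4.
have q2 : (0 < q ^ 2)%N by rewrite expn_gt0 q_gt0.
have h5 := leq_trans h3 h1; split; apply/eqP; rewrite eqn_leq ?h1 ?h2 /=.
  rewrite -(leq_pmul2l q2); apply: leq_trans h4 _; exact: leq_mul.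
apply: leq_trans h3; rewrite -(leq_pmul2r q_gt0); apply: leq_trans h4 _.
exact: leq_mul.
Qed.

Lemma card_fixed : #|fixed| = q.
Proof. by have [] := card_fixed_ker_tr1. Qed.

Lemma card_ker_tr a : a != 0 -> #|ker_tr a| = (q ^ 2)%N.
Proof.
move=> a0; have [_ <-] := card_fixed_ker_tr1.
rewrite -(card_imset (ker_tr 1) (mulfI (invr_neq0 a0))); apply: eq_card => x.
apply/idP/imsetP => [|[z]]; rewrite !inE.
  by move=> hx; exists (a * x); rewrite ?inE ?mul1r // mulKf.
by rewrite mul1r => hz ->; rewrite mulVKf.
Qed.

Lemma card_ker_tr_ge a : (q ^ 2 <= #|ker_tr a|)%N.
Proof.
have [->|/card_ker_tr->//] := eqVneq a 0.
rewrite (_ : ker_tr 0 = setT) ?cardsT 1?ltnW //.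
by apply/setP => x; rewrite !inE mul0r /tr !rmorph0 !addr0 eqxx.
Qed.

Lemma card_wedge0 u : u != 0 -> #|[set x | wedge u x == 0]| = q.
Proof.
move=> u0; rewrite -card_fixed -(card_imset fixed (mulIf u0)); apply: eq_card => x.
apply/idP/imsetP => [|[s]]; rewrite !inE => /eqP h.
  exists (x / u); last by rewrite divfK.
  rewrite inE; apply/eqP/wedge_eq0 => //.
  by rewrite -[RHS]oppr0 -h /wedge; ring.
by move=> ->; rewrite /wedge rmorphM /= h; apply/eqP; ring.
Qed.

Lemma ker_tr_basis a : exists w1 w2,
  [/\ wedge w1 w2 != 0, tr (a * w1) = 0 & tr (a * w2) = 0].
Proof.
have hK := card_ker_tr_ge a.
have [w1] : exists w, w \in ker_tr a :\: [set 0].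
  apply/set0Pn; rewrite -card_gt0 cardsD (leq_trans _ (leq_sub2r _ hK)) //.
  rewrite subn_gt0 (leq_ltn_trans (subset_leq_card (subsetIr _ _))) // cards1.
  exact: leq_ltn_trans ltqq2.
rewrite !inE => /andP[w10 /eqP h1].
have [w2] : exists w, w \in ker_tr a :\: [set x | wedge w1 x == 0].
  apply/set0Pn; rewrite -card_gt0 cardsD (leq_trans _ (leq_sub2r _ hK)) //.
  by rewrite subn_gt0 (leq_ltn_trans (subset_leq_card (subsetIr _ _))) // card_wedge0.
by rewrite !inE => /andP[h /eqP h2]; exists w1, w2.
Qed.

(** [phi (wedge w1 w2)] is the first entry of the cross product of the vectors of conjugates of [w1]
    and [w2], so [tr (phi (wedge w1 w2) * z)] is the determinant of [z], [w1], [w2]. Here two rows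
    coincide. *)
Lemma tr_wedge w1 w2 : (tr (phi (wedge w1 w2) * w1) = 0) * (tr (phi (wedge w1 w2) * w2) = 0).
Proof. by rewrite /tr /wedge !(rmorphM, rmorphB) /= !phi3; split; ring. Qed.

(** Cramer's rule: the vanishing determinant makes both quotients of wedges invariant under
    [phi]. *)
Lemma span_wedge w1 w2 z : wedge w1 w2 != 0 -> tr (phi (wedge w1 w2) * z) = 0 ->
  exists s t, [/\ phi s = s, phi t = t & z = s * w1 + t * w2].
Proof.
move=> h hz; have h' : phi (wedge w1 w2) != 0 by rewrite fmorph_eq0.
exists (wedge z w2 / wedge w1 w2), (wedge w1 z / wedge w1 w2); split.
- rewrite rmorphM fmorphV; apply/eqP; rewrite eqr_div //; apply/eqP.
  have -> : wedge z w2 * phi (wedge w1 w2) = phi (wedge z w2) * wedge w1 w2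
      + phi w2 * tr (phi (wedge w1 w2) * z).
    by rewrite /tr /wedge !(rmorphM, rmorphB) /= !phi3; ring.
  by rewrite hz mulr0 addr0.
- rewrite rmorphM fmorphV; apply/eqP; rewrite eqr_div //; apply/eqP.
  have -> : wedge w1 z * phi (wedge w1 w2) = phi (wedge w1 z) * wedge w1 w2
      - phi w1 * tr (phi (wedge w1 w2) * z).
    by rewrite /tr /wedge !(rmorphM, rmorphB) /= !phi3; ring.
  by rewrite hz mulr0 subr0.
- by move: h; rewrite /wedge => h; field.
Qed.

Lemma ker_tr_wedge0 a b z : a != 0 -> wedge b a = 0 -> tr (a * z) = 0 -> tr (b * z) = 0.
Proof.
move=> a0 /(wedge_eq0 a0) h hz.
by rewrite -[b in LHS](divfK a0) -[_ / a * a * z]mulrA tr_fixM // hz mulr0.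
Qed.

Lemma wedge_ker_tr a w1 w2 : tr (a * w1) = 0 -> tr (a * w2) = 0 ->
  wedge (phi (wedge w1 w2)) a = 0.
Proof.
move=> h1 h2; have -> : wedge (phi (wedge w1 w2)) a =
    phi (phi w2) * tr (a * w1) - phi (phi w1) * tr (a * w2).
  by rewrite /tr /wedge !(rmorphM, rmorphB) /= !phi3; ring.
by rewrite h1 h2 !mulr0 subr0.
Qed.

Lemma ker_tr_span a w1 w2 z : a != 0 -> wedge w1 w2 != 0 ->
    tr (a * w1) = 0 -> tr (a * w2) = 0 -> tr (a * z) = 0 ->
  exists s t, [/\ phi s = s, phi t = t & z = s * w1 + t * w2].
Proof.
by move=> a0 h h1 h2 hz; apply: span_wedge => //; apply: ker_tr_wedge0 hz; rewrite ?wedge_ker_tr.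
Qed.

(** Two lines of PG(2, q) meet: the common point is the cross product of the dual coordinates,
    unless these are dependent. *)
Lemma ker_tr_meet a b : exists2 z, z != 0 & tr (a * z) = 0 /\ tr (b * z) = 0.
Proof.
have [h|h] := eqVneq (wedge a b) 0; last first.
  exists (phi (wedge a b)); first by rewrite fmorph_eq0.
  by rewrite ![_ * phi _]mulrC !tr_wedge.
have [b0|b0] := eqVneq b 0.
  have [w [_ [/wedge_neq0[w0 _] hw _]]] := ker_tr_basis a.
  by exists w; rewrite // b0 mul0r /tr !rmorph0 !addr0.
have [w [_ [/wedge_neq0[w0 _] hw _]]] := ker_tr_basis b; exists w => //.
by split=> //; apply: ker_tr_wedge0 hw.
Qed.

(* The case of Hilbert 90 needed here, by Lagrange resolvents. *)
Lemma nrm1_quotient x : nrm x = 1 -> exists2 z, z != 0 & phi z = x * z.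
Proof.
move=> hx; have x0 : x != 0 by rewrite -nrm_eq0 hx oner_neq0.
(* The degree q^2 is below #|F|, so some value of [p] is nonzero; as [nrm x = 1], [phi] multiplies
   each value of [p] by [x]. *)
pose p : {poly F} := x^-1 *: 'X^(q ^ 2) + 1 *: 'X^q + phi (phi x) *: 'X.
have sz : size p = (q ^ 2).+1 by rewrite size_linearized ?invr_neq0.
have [c hc] : exists c, ~~ root p c.
  apply/existsP; rewrite -negb_forall; apply/negP => /forallP h.
  have : (#|[set: F]| < size p)%N.
    by apply: card_roots_lt => [|y _]; rewrite -?size_poly_eq0 ?sz.
  by rewrite cardsT sz ltnS leqNgt ltq2F.
exists p.[c]; first exact: hc.
rewrite !hornerE exprM -!phiE !(rmorphD, rmorphM, fmorphV) /= !phi3.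
have e : (phi x)^-1 = x * phi (phi x).
  by apply: (mulfI (_ : phi x != 0)); rewrite ?fmorph_eq0 // divff ?fmorph_eq0 // -hx /nrm; ring.
by rewrite e !mulrDr mulVKf //; ring.
Qed.

(** * Cubic curves with 2q + 2 points *)

Section Cubic.

Context (b g d : F) (dE : phi d = d).

(* At x_i = phi^i x with x != 0, this is
   nrm x * (d + tr (b * (phi x / x)) + tr (g * (x / phi x))). *)
Definition cub x0 x1 x2 :=
  b * (x1 ^+ 2 * x2) + phi b * (x2 ^+ 2 * x0) + phi (phi b) * (x0 ^+ 2 * x1)
  + g * (x0 ^+ 2 * x2) + phi g * (x1 ^+ 2 * x0) + phi (phi g) * (x2 ^+ 2 * x1)
  + d * (x0 * x1 * x2).

Definition wedge0 u : {set F} := [set x | wedge u x == 0].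

Definition cubf x := cub x (phi x) (phi (phi x)).

(** The partial derivative of [cub] in [x0]. As [d] is fixed, the other two are conjugate to it at
    conjugate points, so [tr (gradf u * v)] is the derivative of [cubf] at [u] in the direction
    [v]. *)
Definition grad x0 x1 x2 :=
  phi b * x2 ^+ 2 + phi (phi b) * (x0 * x1) *+ 2
  + g * (x0 * x2) *+ 2 + phi g * x1 ^+ 2 + d * (x1 * x2).

Definition gradf x := grad x (phi x) (phi (phi x)).

Lemma cubfD s u v : phi s = s -> cubf (s * u + v) =
  s ^+ 3 * cubf u + s ^+ 2 * tr (gradf u * v) + s * tr (gradf v * u) + cubf v.
Proof.
move=> hs; rewrite /cubf /cub /gradf /grad /tr.
by rewrite !(rmorphM, rmorphD, rmorphXn, rmorphMn) /= !phi3 !hs !dE; ring.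
Qed.

Lemma tr_gradff u : tr (gradf u * u) = cubf u *+ 3.
Proof.
rewrite /cubf /cub /gradf /grad /tr.
by rewrite !(rmorphM, rmorphD, rmorphXn, rmorphMn) /= !phi3 !dE; ring.
Qed.

Lemma cubf0 : cubf 0 = 0.
Proof. by rewrite /cubf /cub !rmorph0; ring. Qed.

Lemma cubfZ s u : phi s = s -> cubf (s * u) = s ^+ 3 * cubf u.
Proof.
by move=> hs; rewrite /cubf /cub !rmorphM /= !hs; ring.
Qed.

(* Vanishing of the four coefficients of the binary cubic form obtained by
   restricting cubf to the plane spanned by u and v over the subfield. *)
Definition in_cubic u v :=
  [&& cubf u == 0, cubf v == 0, tr (gradf u * v) == 0 & tr (gradf v * u) == 0].

Definition line_roots u v := [set s in fixed | cubf (s * u + v) == 0].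

(** As [cubf u = 0], the restriction to the line is a polynomial in [s] of degree at most 2. Its
    leading coefficient vanishes exactly when [v] is a tangent direction, which costs one root. *)
Lemma line_roots_le u v : cubf u = 0 -> ~~ in_cubic u v ->
  (#|line_roots u v| + (v \in ker_tr (gradf u)) <= 2)%N.
Proof.
move=> hu; rewrite /in_cubic hu eqxx inE /=.
set G := cubf v; set A := tr _; set B := tr _ => nz.
pose p : {poly F} := A *: 'X^2 + (B *: 'X + G%:P).
have sub : {in line_roots u v, forall s, root p s}.
  move=> s; rewrite !inE => /andP[/eqP hs]; rewrite cubfD // hu mulr0 add0r -/A -/B -/G => /eqP h.
  apply/eqP; rewrite /p 2!hornerD !hornerZ hornerXn hornerX hornerC -[RHS]h; ring.
have s1 : (size (B *: 'X + G%:P)%R <= 2)%N.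
  by rewrite -mul_polyC size_MXaddC; case: ifP => // _; rewrite ltnS size_polyC leq_b1.
have [A0|A0] := eqVneq A 0; last first.
  have sz : size p = 3%N by rewrite size_polyDl size_scale // size_polyXn.
  have p0 : p != 0 by rewrite -size_poly_eq0 sz.
  by rewrite addn0 -ltnS -sz; apply: card_roots_lt.
rewrite addn1; have pE : p = B *: 'X + G%:P by rewrite /p A0 scale0r add0r.
have p0 : p != 0.
  apply: contraNneq nz => p0.
  have h0 : p`_0 = 0 by rewrite p0 coef0.
  have h1 : p`_1 = 0 by rewrite p0 coef0.
  move: h0 h1; rewrite pE !coefD !coefZ !coefX !coefC /= mulr0 mulr1 add0r addr0 => -> ->.
  by rewrite A0 !eqxx.
by apply: leq_trans s1; rewrite -pE; apply: card_roots_lt.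
Qed.

(** For a multiple [v] of [u] all q scalars may be roots; the extra term covers this case, as 2 + (q
    - 1) = q + 1. *)
Lemma line_roots_bound u v : u != 0 -> cubf u = 0 ->
    (wedge u v != 0 -> ~~ in_cubic u v) ->
  (#|line_roots u v| + (v \in ker_tr (gradf u)) <= 2 + (q - 1) * (v \in wedge0 u))%N.
Proof.
move=> u0 hu h; rewrite [_ \in wedge0 _]inE.
have [w0|w0] := eqVneq (wedge u v) 0; last first.
  by rewrite muln0 addn0 line_roots_le // h.
rewrite muln1; have : (#|line_roots u v| <= q)%N.
  rewrite -card_fixed; apply/subset_leq_card/subsetP => s; by rewrite inE => /andP[].
by case: (_ \in _); lia.
Qed.

(** Double counting: for each fixed [s], translation by [s * u] permutes [F]. *)
Lemma line_roots_sum u :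
  (\sum_(v : F) #|line_roots u v| = q * #|[set v | (cubf v == 0)%R]|)%N.
Proof.
transitivity (\sum_(s in fixed) \sum_(v : F) (cubf (s * u + v) == 0)%R)%N.
  rewrite exchange_big /=; apply: eq_bigr => v _; rewrite -sum1_card.
  rewrite big_mkcond [RHS]big_mkcond /=; apply: eq_bigr => s _.
  by rewrite !inE; case: (_ == s); case: (_ == 0).
rewrite -card_fixed -sum_nat_const; apply: eq_bigr => s _.
rewrite -sum1_card [RHS]big_mkcond /= (reindex_inj (addrI (- (s * u)))) /=.
by apply: eq_bigr => v _; rewrite addNKr inE; case: (_ == 0).
Qed.

Lemma sum_mem (A : {set F}) : (\sum_(x : F) (x \in A) = #|A|)%N.
Proof.
by rewrite -sum1_card [RHS]big_mkcond; apply: eq_bigr => x _; case: (_ \in _).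
Qed.

Context (card_cubf : #|[set v | cubf v == 0]| = ((q - 1) * (2 * q + 2) + 1)%N).

(* A line through the zero u has at most two further zeros, and at most one if it is
   tangent; with card_cubf zeros in all, each of these bounds is attained. *)
Lemma line_roots_eq u : u != 0 -> cubf u = 0 ->
    (forall v, wedge u v != 0 -> ~~ in_cubic u v) ->
  forall v, (#|line_roots u v| + (v \in ker_tr (gradf u)) =
             2 + (q - 1) * (v \in wedge0 u))%N.
Proof.
move=> u0 hu h v; apply/eqP.
have [[Ele Eeq] [S1 S2]] : (\sum_v (#|line_roots u v| + (v \in ker_tr (gradf u)))
   <= \sum_v (2 + (q - 1) * (v \in wedge0 u)) ?= iff
   [forall v : F, #|line_roots u v| + (v \in ker_tr (gradf u)) == 2 + (q - 1) * (v \in wedge0 u)])%N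
  /\ ((\sum_v (#|line_roots u v| + (v \in ker_tr (gradf u)))
    = q * ((q - 1) * (2 * q + 2) + 1) + #|ker_tr (gradf u)|)
   /\ (\sum_v (2 + (q - 1) * (v \in wedge0 u)) = #|F| * 2 + (q - 1) * q))%N.
  split; last split.
  - by apply: leqif_sum => w _; apply/leqif_eq/line_roots_bound => //; apply: h.
  - by rewrite big_split /= line_roots_sum card_cubf sum_mem.
  - rewrite big_split /= sum_nat_const -big_distrr /=.
    by rewrite sum_mem card_wedge0.
suff /forallP/(_ v) : [forall v : F, #|line_roots u v| + (v \in ker_tr (gradf u))
   == 2 + (q - 1) * (v \in wedge0 u)]%N by [].
(* There are 2q^2 - 1 zeros and at least q^2 tangent directions, so the left sum is at least 2q^3 +
   q^2 - q, the value of the right one. *)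
rewrite -Eeq eqn_leq Ele S1 S2 cardF /=.
have := card_ker_tr_ge (gradf u).
by move: q_gt1; case: (q) => // k; rewrite subn1 /= !expnS !expn0; nia.
Qed.

Lemma cubic_plane : exists u v, wedge u v != 0 /\ in_cubic u v.
Proof.
suff : [exists u : F, [exists v : F, (wedge u v != 0) && in_cubic u v]].
  by case/existsP => u /existsP[v /andP[? ?]]; exists u, v.
apply: contraT => /existsPn nocub.
have {}nocub u v : wedge u v != 0 -> ~~ in_cubic u v.
  move=> h; apply: contra (nocub u) => hc.
  by apply/existsP; exists v; rewrite h.
have [u] : exists u, u \in [set v | cubf v == 0] :\ 0.
  apply/set0Pn; rewrite -card_gt0.
  have := cardsD1 0 [set v | cubf v == 0].
  rewrite card_cubf inE cubf0 eqxx addnC => /addnI <-.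
  by rewrite muln_gt0 subn_gt0 q_gt1 addn_gt0 orbT.
rewrite !inE => /andP[u0 /eqP hu].
have Eu := line_roots_eq u0 hu (nocub u).
(* A tangent direction at [u] other than [u]: there are at least q^2 tangent directions, and only q
   multiples of [u]. *)
have [v] : exists v, v \in ker_tr (gradf u) :\: [set v | wedge u v == 0].
  apply/set0Pn; rewrite -card_gt0 cardsD (leq_trans _ (leq_sub2r _ (card_ker_tr_ge _))) //.
  by rewrite subn_gt0 (leq_ltn_trans (subset_leq_card (subsetIr _ _))) // card_wedge0.
rewrite !inE => /andP[huv /eqP Kv].
(* Equality in the bound leaves exactly one root on the tangent; it gives the further zero [w]. *)
have [s] : exists s, s \in line_roots u v.
  apply/set0Pn; rewrite -card_gt0; have := Eu v.
  by rewrite !inE Kv eqxx (negPf huv) muln0 addn0 addn1 => -[->].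
rewrite !inE => /andP[/eqP hs /eqP]; set w := _ + v => hw.
have huw : wedge u w != 0.
  by move: huv; congr (_ != 0); rewrite /w /wedge rmorphD rmorphM /= hs; ring.
have Kw : tr (gradf u * w) = 0.
  rewrite /w mulrDr trD Kv addr0 mulrCA tr_fixM // tr_gradff hu mul0rn.
  by rewrite mulr0.
have := nocub _ _ huw; rewrite /in_cubic hu hw Kw eqxx /= => Kwu.
have hwu : wedge w u != 0 by rewrite -oppr_eq0 (_ : - _ = wedge u w) // /wedge; ring.
have [_ w0] := wedge_neq0 huw.
have := line_roots_eq w0 hw (nocub w) u.
rewrite !inE (negPf Kwu) (negPf hwu) muln0 !addn0 => E2.
(* Equality at [w] demands two roots, but along this line the cubic is [x ^+ 2 * tr (gradf w * u)],
   which vanishes only at [x = 0]. *)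
have : (#|line_roots w u| <= #|[set (0 : F)%R]|)%N.
  apply/subset_leq_card/subsetP => x; rewrite !inE => /andP[/eqP hx].
  rewrite cubfD // hw hu Kw !mulr0 add0r !addr0 mulf_eq0 (negPf Kwu) orbF.
  by rewrite expf_eq0.
by rewrite E2 cards1.
Qed.

(** The cubic vanishes on the line with dual coordinate [a], so [tr (a * x)] divides it. Since [cub]
    has no cubes of single variables, the quadratic cofactor has no squares, which leaves the form
    [nrm x * tr (e / x)]. *)
Lemma cubic_factor u v : wedge u v != 0 -> in_cubic u v ->
  exists e, let a := phi (wedge u v) in
    [/\ b = phi a * e, g = a * phi e & d = tr (a * e)].
Proof.
move=> huv /and4P[/eqP hu /eqP hv /eqP huv1 /eqP hvu1].
pose a := phi (wedge u v); have a0 : a != 0 by rewrite fmorph_eq0.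
have pa0 : phi a != 0 by rewrite fmorph_eq0.
have line s t : s * s * s * cubf u + s * s * t * tr (gradf u * v)
    + s * t * t * tr (gradf v * u) + t * t * t * cubf v = 0.
  by rewrite hu hv huv1 hvu1 !mulr0 !addr0.
(* All four coefficients of the binary form vanish, so [s] and [t] may be taken outside the
   subfield. This choice is the point (-phi a, a, 0) of the extended line. *)
have e1 : a * phi a * (phi a * phi (phi b) - a * phi g) = 0.
  rewrite -[RHS](line (phi (phi v)) (- phi (phi u))) /a /wedge.
  rewrite /cubf /cub /gradf /grad /tr.
  by rewrite !(rmorphM, rmorphB, rmorphD, rmorphXn, rmorphMn) /= !phi3 !dE; ring.
have e2 : a * phi g = phi a * phi (phi b).
  by apply/eqP; rewrite eq_sym -subr_eq0; have /eqP := e1; rewrite !mulf_eq0 (negPf a0) (negPf pa0).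
have e3 : phi a * phi (phi g) = phi (phi a) * b.
  by have := congr1 phi e2; rewrite !rmorphM /= phi3.
have e4 : phi (phi a) * g = a * phi b.
  by have := congr1 phi e3; rewrite !rmorphM /= !phi3.
exists (b / phi a); rewrite -/a.
have ppa0 : phi (phi a) != 0 by rewrite fmorph_eq0.
have E1 : b = phi a * (b / phi a) by rewrite mulrC divfK.
have E2 : g = a * phi (b / phi a).
  by rewrite rmorphM fmorphV /= mulrA -e4 mulrAC divff // mul1r.
split=> //.
have [_ tau] := tr_wedge u v.
have [u0 v0] := wedge_neq0 huv.
set e := b / phi a in E1 E2 *.
(* The remaining coefficient is found by evaluating at [v], a nonzero point of the line. *)
have : (d - tr (a * e)) * nrm v = 0.
  have -> : (d - tr (a * e)) * nrm v = cubf v - tr (a * v) *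
     (e * phi v * phi (phi v) + phi e * v * phi (phi v) + phi (phi e) * v * phi v).
    rewrite /cubf /cub E1 E2 /tr /nrm; move: (a) (e) => a' e'.
    rewrite !(rmorphM, rmorphD) /= !phi3.
    by move: (phi a') (phi (phi a')) (phi e') (phi (phi e')) (phi v) (phi (phi v)) => *; ring.
  by rewrite hv tau mul0r subrr.
move/eqP; rewrite mulf_eq0 nrm_eq0 (negPf v0) orbF subr_eq0 => /eqP; exact.
Qed.

End Cubic.

(** * Splashes of a line in coordinates *)

Definition rv x y : 'rV[F]_2 := \row_j (if j == 0 then x else y).
(** For [x != 0] this is proportional to (x^(q-1), 1); by Hilbert 90 these are the pairs whose ratio
    has norm 1. *)
Definition mv x := rv (phi x) x.

(* The rows of E are a basis of the line. Swapping them amounts to x |-> 1 / x, so the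
   sets arc E a are the sublines coming from points of the subplane and the sets
   arc (xrow 0 1 E) e those coming from special dual conics. *)
Definition splash_pts (E : 'M[F]_(2, 3)) : {set 'M[F]_3} :=
  [set <<mv x *m E>>%MS | x : F & x != 0].
Definition arc (E : 'M[F]_(2, 3)) a : {set 'M[F]_3} :=
  [set <<mv x *m E>>%MS | x : F & (x != 0) && (x \in ker_tr a)].

Lemma rvE (r : 'rV[F]_2) : r = rv (r 0 0) (r 0 1).
Proof.
apply/rowP => j; rewrite mxE; case: j => [[|[|//]] hj] /=; congr (r _ _); exact: val_inj.
Qed.

Lemma rv_inj x y x' y' : rv x y = rv x' y' -> x = x' /\ y = y'.
Proof. by move/rowP => h; have := h 0; have := h 1; rewrite !mxE /= => -> ->. Qed.

Lemma rv_mul x y (H : 'M[F]_2) :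
  rv x y *m H = rv (x * H 0 0 + y * H 1 0) (x * H 0 1 + y * H 1 1).
Proof.
have e : lift ord0 ord0 = 1 :> 'I_2 by apply: val_inj.
by rewrite [LHS]rvE !mxE !big_ord_recl !big_ord0 !mxE /= !addr0 !e.
Qed.

Lemma scale_rv k x y : k *: rv x y = rv (k * x) (k * y).
Proof. by rewrite [LHS]rvE !mxE. Qed.

Lemma rv_eq0 x y : (rv x y == 0) = (x == 0) && (y == 0).
Proof.
have -> : 0 = rv 0 0 by rewrite [LHS]rvE !mxE.
by apply/eqP/andP => [/rv_inj[-> ->]//|[/eqP-> /eqP->]].
Qed.

Lemma mv_eq0 x : (mv x == 0) = (x == 0).
Proof. by rewrite rv_eq0 fmorph_eq0 andbb. Qed.

Lemma rv_xrow x y (E : 'M[F]_(2, 3)) : rv x y *m xrow 0 1 E = rv y x *m E.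
Proof.
rewrite xrowE mulmxA rv_mul !mxE /= tpermL tpermR /= !mulr0 !mulr1 add0r addr0.
by [].
Qed.

Lemma mxrank_xrow (E : 'M[F]_(2, 3)) : (xrow 0 1 E :=: E)%MS.
Proof. by rewrite xrowE; apply/eqmxMfull; rewrite row_full_unit unitmx_perm. Qed.

Lemma pt_scale k (r : 'rV[F]_2) (E : 'M[F]_(2, 3)) : k != 0 ->
  <<(k *: r) *m E>>%MS = <<r *m E>>%MS.
Proof. by move=> k0; rewrite -scalemxAl; apply/eq_genmx/eqmx_scale. Qed.

Lemma pt_inj (r r' : 'rV[F]_2) (E : 'M[F]_(2, 3)) : row_free E -> r != 0 ->
  <<r *m E>>%MS = <<r' *m E>>%MS -> exists2 k, k != 0 & r = k *: r'.
Proof.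
move=> fE r0 /genmxP/andP[+ _]; rewrite submxMfree // => /sub_rVP[k e].
by exists k => //; apply: contraNneq r0 => k0; rewrite e k0 scale0r.
Qed.

Lemma pt_eq x y (E : 'M[F]_(2, 3)) : row_free E -> x != 0 -> y != 0 ->
  (<<mv x *m E>>%MS == <<mv y *m E>>%MS) = (wedge x y == 0).
Proof.
move=> fE x0 y0; apply/eqP/eqP => [e|h].
  have [|k k0] := pt_inj fE _ e; first by rewrite mv_eq0.
  by rewrite scale_rv => /rv_inj[]; rewrite /wedge => -> e2; rewrite {1}e2; ring.
have hs := wedge_eq0 y0 h; rewrite -[x](divfK y0) /mv rmorphM hs -scale_rv pt_scale //.
by rewrite mulf_neq0 ?invr_neq0.
Qed.

(** Over each point lie the q - 1 nonzero subfield multiples of one representative. *)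
Lemma card_pts (E : 'M[F]_(2, 3)) (A : {set F}) : row_free E -> 0 \notin A ->
    (forall x s, x \in A -> s != 0 -> phi s = s -> s * x \in A) ->
  #|A| = (#|[set <<mv x *m E>>%MS | x in A]| * (q - 1))%N.
Proof.
move=> fE A0 hA; apply: card_fibers => x xA.
have x0 : x != 0 by apply: contraNneq A0 => <-.
have -> : [set z in A | <<mv z *m E>>%MS == <<mv x *m E>>%MS] = wedge0 x :\ 0.
  apply/setP => z; rewrite !inE; have [->|z0] := eqVneq z 0; first by rewrite (negPf A0).
  rewrite pt_eq //= -oppr_eq0 (_ : - _ = wedge x z) ?andb_idl //; last by rewrite /wedge; ring.
  move=> /eqP h; have h' : wedge z x = 0 by rewrite -[RHS]oppr0 -h /wedge; ring.
  rewrite -[z](divfK x0); apply: hA; rewrite ?wedge_eq0 //.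
  by rewrite mulf_neq0 ?invr_neq0.
have := cardsD1 0 (wedge0 x); rewrite card_wedge0 // inE /wedge rmorph0 !mulr0 subr0 eqxx.
by move=> ->; rewrite addnC addnK.
Qed.

Lemma tr_lin a s t x y : phi s = s -> phi t = t ->
  tr (a * (s * x + t * y)) = s * tr (a * x) + t * tr (a * y).
Proof. by move=> hs ht; rewrite -!tr_fixM // -trD; congr tr; ring. Qed.

Lemma arcE (E : 'M[F]_(2, 3)) a :
  arc E a = [set <<mv x *m E>>%MS | x in ker_tr a :\ 0].
Proof.
by apply/setP => P; apply/imsetP/imsetP => -[x hx ->]; exists x; move: hx; rewrite // !inE.
Qed.

Lemma card_arc (E : 'M[F]_(2, 3)) a : row_free E -> a != 0 -> #|arc E a| = q.+1.
Proof.
move=> fE a0; have q1 : (0 < q - 1)%N by rewrite subn_gt0.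
apply/eqP; rewrite -(eqn_pmul2r q1) arcE -card_pts //.
- have := cardsD1 0 (ker_tr a); rewrite card_ker_tr // inE mulr0 /tr !rmorph0 !addr0 eqxx.
  by move=> h; rewrite -(eqn_add2l 1) -h; apply/eqP; move: q_gt1; clear; nia.
- by rewrite !inE eqxx.
- move=> x s; rewrite !inE => /andP[x0 /eqP hx] s0 hs.
  by rewrite mulf_neq0 //= mulrCA tr_fixM // hx mulr0.
Qed.

Lemma card_splash_pts (E : 'M[F]_(2, 3)) : row_free E ->
  #|splash_pts E| = (q ^ 2 + q + 1)%N.
Proof.
move=> fE; have q1 : (0 < q - 1)%N by rewrite subn_gt0.
apply/eqP; rewrite -(eqn_pmul2r q1).
have -> : splash_pts E = [set <<mv x *m E>>%MS | x in setT :\ 0].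
  by apply/setP => P; apply/imsetP/imsetP => -[x hx ->]; exists x; move: hx; rewrite // !inE ?andbT.
rewrite -card_pts //; last 2 first.
- by rewrite !inE eqxx.
- by move=> x s; rewrite !inE !andbT => x0 s0 _; rewrite mulf_neq0.
have := cardsD1 0 [set: F]; rewrite cardsT inE cardF.
by move=> h; rewrite -(eqn_add2l 1) -h; apply/eqP; move: q_gt1; clear; nia.
Qed.

Lemma mv_span s t x y : phi s = s -> phi t = t ->
  mv (s * x + t * y) = s *: mv x + t *: mv y.
Proof.
move=> hs ht; rewrite /mv rmorphD !rmorphM /= hs ht !scale_rv.
by rewrite [RHS]rvE !mxE.
Qed.

(** [mv] is linear over the subfield, so a basis [w1], [w2] of the plane [ker_tr a] carries PG(1, q)
    onto the arc; the nonzero wedge makes [W] invertible over [F]. *)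
Lemma sublineP (E : 'M[F]_(2, 3)) (l : 'M[F]_3) a : row_free E -> (E == l)%MS -> a != 0 ->
  subline q l (arc E a).
Proof.
move=> fE El a0; have [w1 [w2 [w0 h1 h2]]] := ker_tr_basis a.
pose W : 'M[F]_2 := \matrix_(i, j) (if i == 0 then mv w1 else mv w2) 0 j.
have WE s t : rv s t *m W = s *: mv w1 + t *: mv w2.
  by rewrite rv_mul !mxE /= !scale_rv [RHS]rvE !mxE.
have Wu : W \in unitmx.
  rewrite -row_free_unit; apply: inj_row_free => r; rewrite [r]rvE WE !scale_rv.
  set s := r 0 0; set t := r 0 1; move/rowP => h.
  have := h 0; have := h 1; rewrite !mxE /= => e1 e2.
  have es : s * wedge w1 w2 = 0.
    have -> : s * wedge w1 w2 = (s * w1 + t * w2) * phi w2 - (s * phi w1 + t * phi w2) * w2.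
      by rewrite /wedge; ring.
    by rewrite e1 e2 !mul0r subr0.
  have et : t * wedge w1 w2 = 0.
    have -> : t * wedge w1 w2 = (s * phi w1 + t * phi w2) * w1 - (s * w1 + t * w2) * phi w1.
      by rewrite /wedge; ring.
    by rewrite e1 e2 !mul0r subr0.
  apply/eqP; rewrite rv_eq0; move/eqP: es; move/eqP: et.
  by rewrite !mulf_eq0 (negPf w0) !orbF => -> ->.
have WEE : (W *m E :=: E)%MS by apply: eqmxMfull; rewrite row_full_unit.
exists (W *m E); split.
- by rewrite /row_free WEE; apply: fE.
- by rewrite !WEE.
have mvW s t : phi s = s -> phi t = t ->
    rv s t *m (W *m E) = mv (s * w1 + t * w2) *m E.
  by move=> hs ht; rewrite mulmxA WE mv_span.
apply/setP => P; apply/imsetP/imsetP => [[x]|[r]]; rewrite !inE.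
  case/andP=> x0 /eqP hx ->.
  have [s [t [hs ht ex]]] := ker_tr_span a0 w0 h1 h2 hx.
  exists (rv s t); last by rewrite mvW // -ex.
  rewrite inE rv_eq0; apply/andP; split.
    by apply/mxOverP => i j; rewrite mxE inE -phiE; case: ifP => _; apply/eqP.
  apply: contraNN x0 => /andP[/eqP s0 /eqP t0].
  by rewrite ex s0 t0 !mul0r addr0.
case/andP=> /mxOverP hr r0 ->.
have hs : phi (r 0 0) = r 0 0 by rewrite phiE; apply/eqP/hr.
have ht : phi (r 0 1) = r 0 1 by rewrite phiE; apply/eqP/hr.
exists (r 0 0 * w1 + r 0 1 * w2); last by rewrite -mvW // -rvE.
rewrite !inE tr_lin // h1 h2 !mulr0 addr0 eqxx andbT.
rewrite -mv_eq0 mv_span // -WE -rvE; apply: contraNneq r0 => h.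
by rewrite -[r](mulmxK Wu) h mul0mx.
Qed.

(** A subfield-linear map without zeros on the plane of [a] sends it onto another plane, whose dual
    coordinate is the cross product of the images of a basis. *)
Lemma arc_transport (E E' : 'M[F]_(2, 3)) a (psi : F -> F) : a != 0 ->
    (forall s t x y, phi s = s -> phi t = t -> psi (s * x + t * y) = s * psi x + t * psi y) ->
    (forall x, x != 0 -> tr (a * x) = 0 -> psi x != 0 /\
       exists2 k, k != 0 & mv x *m E = k *: mv (psi x) *m E') ->
  exists2 a' : F, a' != 0 & arc E a = arc E' a'.
Proof.
move=> a0 psiD hpsi; have [w1 [w2 [w0 h1 h2]]] := ker_tr_basis a.
have [w10 w20] := wedge_neq0 w0.
have tr0 s t : phi s = s -> phi t = t -> tr (a * (s * w1 + t * w2)) = 0.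
  by move=> hs ht; rewrite tr_lin // h1 h2 !mulr0 addr0.
(* If the images were dependent with ratio [s], then [psi] would vanish at [s * w2 - w1], which is
   nonzero by independence of [w1] and [w2]. *)
have pw : wedge (psi w1) (psi w2) != 0.
  apply: contraNneq w0 => h; have [p2 _] := hpsi w2 w20 h2.
  have hs := wedge_eq0 p2 h; set s := _ / _ in hs.
  have hN1 : phi (-1) = -1 by rewrite rmorphN1.
  have [e|ne] := eqVneq (s * w2 + (-1) * w1) 0.
    have -> : w1 = s * w2 by apply/eqP; rewrite eq_sym -subr_eq0 -mulN1r e.
    by rewrite /wedge rmorphM /= hs; apply/eqP; ring.
  have [|+ _] := hpsi _ ne.
    by rewrite tr_lin // h1 h2 !mulr0 addr0.
  by rewrite psiD // /s divfK // mulN1r subrr eqxx.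
exists (phi (wedge (psi w1) (psi w2))); first by rewrite fmorph_eq0.
apply/setP => P; apply/imsetP/imsetP => [[x]|[y]]; rewrite !inE => /andP[z0 /eqP hz] ->.
  have [s [t [hs ht ex]]] := ker_tr_span a0 w0 h1 h2 hz.
  have [p0 [k k0 ->]] := hpsi x z0 hz.
  exists (psi x); last by rewrite pt_scale.
  rewrite !inE p0 ex psiD // tr_lin // !tr_wedge.
  by rewrite !mulr0 addr0 eqxx.
have [s [t [hs ht ey]]] := span_wedge pw hz.
have ex : psi (s * w1 + t * w2) = y by rewrite psiD.
have x0 : s * w1 + t * w2 != 0.
  apply: contraNneq z0 => h; rewrite -ex h.
  by have := psiD 0 0 0 0 (rmorph0 _) (rmorph0 _); rewrite !mul0r addr0 => ->.
have [_ [k k0 e]] := hpsi _ x0 (tr0 _ _ hs ht).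
exists (s * w1 + t * w2); first by rewrite !inE x0 tr0 ?eqxx.
by rewrite e ex pt_scale.
Qed.

(** * Carrying a subline of one splash to the other *)

Section Transfer.

Context (a b c d al e : F) (det0 : a * d - b * c != 0) (al0 : al != 0).
Context (hb : a * phi b * phi (phi b) - c * phi d * phi (phi d) = phi al * e).
Context (hg : b * phi a * phi (phi a) - d * phi c * phi (phi c) = al * phi e).
Context (hd : nrm a + nrm b - nrm c - nrm d = tr (al * e)).

Let L x := a * phi x + b * x.
Let M x := c * phi x + d * x.

(** The factorization in independent variables, so that it can be evaluated away from triples of
    conjugates. The hypotheses give three of the seven coefficients and their conjugates give the
    rest. *)
Let cubic_product x0 x1 x2 :
  (a * x1 + b * x0) * (phi a * x2 + phi b * x1) * (phi (phi a) * x0 + phi (phi b) * x2)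
  - (c * x1 + d * x0) * (phi c * x2 + phi d * x1) * (phi (phi c) * x0 + phi (phi d) * x2)
  = (al * x0 + phi al * x1 + phi (phi al) * x2) *
    (e * (x1 * x2) + phi e * (x2 * x0) + phi (phi e) * (x0 * x1)).
Proof.
have hb1 : phi a * phi (phi b) * b - phi c * phi (phi d) * d = phi (phi al) * phi e.
  by have := congr1 phi hb; rewrite !(rmorphB, rmorphM) /= !phi3.
have hb2 : phi (phi a) * b * phi b - phi (phi c) * d * phi d = al * phi (phi e).
  by have := congr1 phi hb1; rewrite !(rmorphB, rmorphM) /= !phi3.
have hg1 : phi b * phi (phi a) * a - phi d * phi (phi c) * c = phi al * phi (phi e).
  by have := congr1 phi hg; rewrite !(rmorphB, rmorphM) /= !phi3.
have hg2 : phi (phi b) * a * phi a - phi (phi d) * c * phi c = phi (phi al) * e.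
  by have := congr1 phi hg1; rewrite !(rmorphB, rmorphM) /= !phi3.
pose B0 := a * phi b * phi (phi b) - c * phi d * phi (phi d).
pose B1 := phi a * phi (phi b) * b - phi c * phi (phi d) * d.
pose B2 := phi (phi a) * b * phi b - phi (phi c) * d * phi d.
pose G0 := b * phi a * phi (phi a) - d * phi c * phi (phi c).
pose G1 := phi b * phi (phi a) * a - phi d * phi (phi c) * c.
pose G2 := phi (phi b) * a * phi a - phi (phi d) * c * phi c.
transitivity (B0 * (x1 * x1 * x2) + B1 * (x2 * x2 * x0) + B2 * (x0 * x0 * x1)
  + G0 * (x0 * x0 * x2) + G1 * (x1 * x1 * x0) + G2 * (x2 * x2 * x1)
  + (nrm a + nrm b - nrm c - nrm d) * (x0 * x1 * x2)).
  rewrite /B0 /B1 /B2 /G0 /G1 /G2 /nrm.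
  move: (phi a) (phi (phi a)) (phi b) (phi (phi b)) (phi c) (phi (phi c)) (phi d) (phi (phi d)).
  by move=> *; ring.
rewrite /B0 hb /B1 hb1 /B2 hb2 /G0 hg /G1 hg1 /G2 hg2 hd /tr !rmorphM /=.
by move: (phi al) (phi (phi al)) (phi e) (phi (phi e)) => *; ring.
Qed.

Lemma nrm_forms x : tr (al * x) = 0 -> nrm (L x) = nrm (M x).
Proof.
move=> hx; apply/eqP; rewrite -subr_eq0 /nrm /L /M.
have := cubic_product x (phi x) (phi (phi x)).
rewrite -!rmorphM /= -/(tr (al * x)) hx mul0r => <-.
by apply/eqP; rewrite !(rmorphD, rmorphM) /= !phi3; ring.
Qed.

Lemma form_neq0 x : x != 0 -> tr (al * x) = 0 -> (L x != 0) * (M x != 0).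
Proof.
move=> x0 hx; have h := nrm_forms hx.
suff LM : ~~ ((L x == 0) && (M x == 0)).
  by move: LM; rewrite -[L x == 0]nrm_eq0 h nrm_eq0 andbb => ->.
apply: contraNN x0 => /andP[/eqP L0 /eqP M0].
have : (a * d - b * c) * x = 0.
  have -> : (a * d - b * c) * x = a * M x - c * L x by rewrite /L /M; ring.
  by rewrite L0 M0 !mulr0 subr0.
by move/eqP; rewrite mulf_eq0 (negPf det0).
Qed.

(* The two products of conjugate linear forms agree on the plane al^T X = 0;
   evaluating at the zero of the form M there shows that M is proportional to
   a conjugate of L, other than L itself as the determinant is nonzero. *)
Lemma conjugate_forms :
  (forall x y, tr (al * x) = 0 -> tr (al * y) = 0 -> phi (L x) * M y = phi (L y) * M x) \/
  (forall x y, tr (al * x) = 0 -> tr (al * y) = 0 ->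
     phi (phi (L x)) * M y = phi (phi (L y)) * M x).
Proof.
have pal : phi (phi al) != 0 by rewrite !fmorph_eq0.
(* The point of the plane where [c * x1 + d * x0] vanishes. There [a * x1 + b * x0] is nonzero by
   [det0], so one of its two conjugates vanishes. *)
have := cubic_product (c * phi (phi al)) (- (d * phi (phi al))) (d * phi al - c * al).
have -> : c * - (d * phi (phi al)) + d * (c * phi (phi al)) = 0 by ring.
have -> : al * (c * phi (phi al)) + phi al * - (d * phi (phi al))
   + phi (phi al) * (d * phi al - c * al) = 0 by ring.
have -> : a * - (d * phi (phi al)) + b * (c * phi (phi al)) = - ((a * d - b * c) * phi (phi al)).
  by ring.
rewrite !mul0r subr0 => /eqP; rewrite !mulf_eq0 oppr_eq0 mulf_eq0 (negPf det0) (negPf pal) /=.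
(* The cross product of two points of the plane is a multiple of the dual vector of the plane, so a
   single determinant decides whether two forms are proportional on it. *)
have cross x y : tr (al * x) = 0 -> tr (al * y) = 0 ->
    exists k, [/\ phi x * phi (phi y) - phi (phi x) * phi y = k * al,
      phi (phi x) * y - x * phi (phi y) = k * phi al & x * phi y - phi x * y = k * phi (phi al)].
  move=> hx hy; have h := wedge_eq0 al0 (wedge_ker_tr hx hy).
  have kE : phi (wedge x y) = phi (wedge x y) / al * al by rewrite divfK.
  move: h kE; move: (phi (wedge x y) / al) => k h kE; exists k; split.
  - by rewrite -kE /wedge rmorphB !rmorphM.
  - by rewrite -h -rmorphM /= -kE /wedge !(rmorphB, rmorphM) /= !phi3; ring.
  - have -> : k * phi (phi al) = phi (phi (k * al)) by rewrite !rmorphM /= !h.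
    by rewrite -kE /wedge !(rmorphB, rmorphM) /= !phi3.
case/orP=> /eqP h; [left|right] => x y hx hy; have [k [e0 e1 e2]] := cross x y hx hy;
  apply/eqP; rewrite -subr_eq0 /L /M !(rmorphD, rmorphM) /= ?phi3; apply/eqP.
- transitivity (k * (phi a * (d * phi al - c * al) + phi b * - (d * phi (phi al)))); last first.
    by rewrite h mulr0.
  transitivity (phi a * (d * (k * phi al) - c * (k * al)) + phi b * - (d * (k * phi (phi al)))).
    by rewrite -e0 -e1 -e2; ring.
  by ring.
- transitivity (k * (phi (phi a) * (c * phi (phi al)) + phi (phi b) * (d * phi al - c * al)));
    last first.
    by rewrite h mulr0.
  transitivity (phi (phi a) * (c * (k * phi (phi al)))
      + phi (phi b) * (d * (k * phi al) - c * (k * al))).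
    by rewrite -e0 -e1 -e2; ring.
  by ring.
Qed.

(** On the plane, [M / phi L] or [L / phi M] is a constant of norm 1. Hilbert 90 then gives a factor
    [mu] that brings (L, M) to the shape (y, phi y) or (phi y, y). *)
Lemma form_multiplier : exists2 mu, mu != 0 &
  (forall x, tr (al * x) = 0 -> phi (mu * L x) = mu * M x) \/
  (forall x, tr (al * x) = 0 -> phi (mu * M x) = mu * L x).
Proof.
have [w [_ [/wedge_neq0[w0 _] hw _]]] := ker_tr_basis al.
have [L0 M0] := form_neq0 w0 hw; have hN := nrm_forms hw.
case: conjugate_forms => h.
  have [|mu mu0 hmu] := @nrm1_quotient (M w / phi (L w)).
    by rewrite nrmM -hN -nrm_phi -nrmM divff ?fmorph_eq0 // /nrm !rmorph1 !mul1r.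
  exists mu => //; left=> x hx; rewrite rmorphM hmu /=.
  have pL : phi (L w) != 0 by rewrite fmorph_eq0.
  by apply: (mulIf pL); rewrite -[RHS]mulrA [M x * _]mulrC -h //; field.
have [|mu mu0 hmu] := @nrm1_quotient (L w / phi (M w)).
  by rewrite nrmM hN -nrm_phi -nrmM divff ?fmorph_eq0 // /nrm !rmorph1 !mul1r.
exists mu => //; right=> x hx; rewrite rmorphM hmu /=.
have pM : phi (M w) != 0 by rewrite fmorph_eq0.
have e1 : phi (M w) * L x = phi (M x) * L w.
  by have := congr1 phi (h w x hw hx); rewrite !rmorphM /= !phi3 mulrC => ->; rewrite mulrC.
by apply: (mulIf pM); rewrite -[RHS]mulrA [L x * _]mulrC e1; field.
Qed.

Lemma arc_transfer (E E' : 'M[F]_(2, 3)) :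
    (forall x, mv x *m E = rv (L x) (M x) *m E') ->
  exists2 al' : F, al' != 0 & arc E al = arc E' al' \/ arc E al = arc (xrow 0 1 E') al'.
Proof.
move=> hE; have [mu mu0 hmu] := form_multiplier.
have mu'0 : mu^-1 != 0 by rewrite invr_neq0.
have lin (f g s t x y : F) : phi s = s -> phi t = t ->
    mu * (f * phi (s * x + t * y) + g * (s * x + t * y)) =
    s * (mu * (f * phi x + g * x)) + t * (mu * (f * phi y + g * y)).
  by move=> hs ht; rewrite rmorphD !rmorphM /= hs ht; ring.
case: hmu => h.
  have [|x x0 hx|al' al'0 ->] := @arc_transport E (xrow 0 1 E') al (fun x => mu * L x) al0.
  - by move=> *; apply: lin.
  - split; first by rewrite mulf_neq0 ?form_neq0.
    exists mu^-1 => //; rewrite hE /mv h // scale_rv rv_xrow.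
    by rewrite !mulKf.
  by exists al' => //; right.
have [|x x0 hx|al' al'0 ->] := @arc_transport E E' al (fun x => mu * M x) al0.
- by move=> *; apply: lin.
- split; first by rewrite mulf_neq0 ?form_neq0.
  by exists mu^-1 => //; rewrite hE /mv h // scale_rv !mulKf.
by exists al' => //; left.
Qed.

End Transfer.

(** * Two splashes on one line *)

Lemma arc_meet (E : 'M[F]_(2, 3)) a a' : ~~ [disjoint arc E a & arc E a'].
Proof.
have [z z0 [h h']] := ker_tr_meet a a'; apply/pred0Pn; exists <<mv z *m E>>%MS => /=.
by apply/andP; split; apply/imsetP; exists z; rewrite // !inE z0 ?h ?h' eqxx.
Qed.

(** Equal norms make [x / y] a quotient [phi z / z] by Hilbert 90. *)
Lemma mem_splash_pts (E : 'M[F]_(2, 3)) x y : row_free E -> (x != 0) || (y != 0) ->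
  (<<rv x y *m E>>%MS \in splash_pts E) = (nrm x == nrm y).
Proof.
move=> fE xy0; have r0 : rv x y != 0 by rewrite rv_eq0 negb_and.
apply/imsetP/eqP => [[z]|hN].
  rewrite inE => z0 /(pt_inj fE r0)[k k0]; rewrite scale_rv => /rv_inj[-> ->].
  by rewrite !nrmM nrm_phi.
have [x0 y0] : x != 0 /\ y != 0.
  by move: xy0; rewrite -[x == 0]nrm_eq0 -[y == 0]nrm_eq0 hN orbb; split.
have [|z z0 hz] := @nrm1_quotient (x / y).
  by rewrite nrmM hN -nrmM divff // /nrm !rmorph1 !mul1r.
exists z; rewrite ?inE //.
have -> : rv x y = (y / z) *: mv z by rewrite scale_rv hz; congr rv; field; rewrite ?z0 ?y0.
by rewrite pt_scale // mulf_neq0 ?invr_neq0.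
Qed.

Lemma pt_xrow x (E : 'M[F]_(2, 3)) : x != 0 ->
  <<mv x^-1 *m xrow 0 1 E>>%MS = <<mv x *m E>>%MS.
Proof.
move=> x0; have px0 : phi x != 0 by rewrite fmorph_eq0.
rewrite rv_xrow -(@pt_scale (x * phi x) (rv x^-1 _)) ?mulf_neq0 // scale_rv.
by rewrite fmorphV mulfK // mulrAC divff // mul1r.
Qed.

Lemma row_free_factor (E E' : 'M[F]_(2, 3)) H : row_free E -> E = H *m E' -> row_free H.
Proof. by move=> fE e; rewrite -row_leq_rank -{1}(eqP fE) e mxrankM_maxl. Qed.

Lemma row_free2 (H : 'M[F]_2) : row_free H -> H 0 0 * H 1 1 - H 1 0 * H 0 1 != 0.
Proof.
move=> fH; apply/negP => /eqP h0.
have e1 : rv (H 1 1) (- H 0 1) = 0.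
  apply: (row_free_inj fH); rewrite mul0mx rv_mul; apply/eqP; rewrite rv_eq0.
  by apply/andP; split; apply/eqP; [rewrite -[RHS]h0|]; ring.
have e2 : rv (H 1 0) (- H 0 0) = 0.
  apply: (row_free_inj fH); rewrite mul0mx rv_mul; apply/eqP; rewrite rv_eq0.
  by apply/andP; split; apply/eqP; [|rewrite -[RHS]oppr0 -h0]; ring.
move/eqP: e1; move/eqP: e2; rewrite !rv_eq0 !oppr_eq0 => /andP[b0 a0] /andP[d0 c0].
have : rv 1 0 = 0.
  apply: (row_free_inj fH); rewrite mul0mx rv_mul; apply/eqP; rewrite rv_eq0.
  by rewrite !mul1r !mul0r !addr0 a0 c0.
by move/eqP; rewrite rv_eq0 oner_eq0.
Qed.

Lemma two_splashes (E1 E2 : 'M[F]_(2, 3)) : row_free E1 -> row_free E2 -> (E1 == E2)%MS ->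
    #|splash_pts E1 :&: splash_pts E2| = (2 * q + 2)%N ->
  exists a e : F, [/\ a != 0, e != 0,
    splash_pts E1 :&: splash_pts E2 = arc E1 a :|: arc (xrow 0 1 E1) e,
    [disjoint arc E1 a & arc (xrow 0 1 E1) e] &
    exists a' e' : F, [/\ a' != 0, e' != 0 &
      arc E1 a = arc E2 a' /\ arc (xrow 0 1 E1) e = arc (xrow 0 1 E2) e' \/
      arc E1 a = arc (xrow 0 1 E2) a' /\ arc (xrow 0 1 E1) e = arc E2 e']].
Proof.
move=> f1 f2 /andP[/submxP[H E1E] _] hcard.
pose a : F := H 0 0; pose b : F := H 1 0; pose c : F := H 0 1; pose d : F := H 1 1.
pose L x := a * phi x + b * x; pose M x := c * phi x + d * x.
have hE x : mv x *m E1 = rv (L x) (M x) *m E2.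
  by rewrite E1E mulmxA rv_mul /L /M /a /b /c /d; congr (rv _ _ *m _); ring.
have det0 : a * d - b * c != 0 by apply/row_free2/(row_free_factor f1 E1E).
pose D := nrm a + nrm b - nrm c - nrm d.
pose B := a * phi b * phi (phi b) - c * phi d * phi (phi d).
pose G := b * phi a * phi (phi a) - d * phi c * phi (phi c).
have dE : phi D = D by rewrite /D !(rmorphB, rmorphD) /= /nrm !rmorphM /= !phi3; ring.
have cubE x : cubf B G D x = nrm (L x) - nrm (M x).
  rewrite /cubf /cub /B /G /D /L /M /nrm !(rmorphB, rmorphD, rmorphM) /= !phi3.
  move: (phi a) (phi (phi a)) (phi b) (phi (phi b)) (phi c) (phi (phi c)) (phi d) (phi (phi d)).
  by move: (phi x) (phi (phi x)) => *; ring.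
have LM0 x : x != 0 -> (L x != 0) || (M x != 0).
  apply: contraNT; rewrite negb_or !negbK => /andP[/eqP L0 /eqP M0].
  have : (a * d - b * c) * x = 0.
    have -> : (a * d - b * c) * x = a * M x - c * L x by rewrite /L /M; ring.
    by rewrite L0 M0 !mulr0 subr0.
  by move/eqP; rewrite mulf_eq0 (negPf det0).
have in2 x : x != 0 -> (<<mv x *m E1>>%MS \in splash_pts E2) = (cubf B G D x == 0).
  by move=> x0; rewrite hE mem_splash_pts ?LM0 // cubE subr_eq0.
have SE : splash_pts E1 :&: splash_pts E2 =
    [set <<mv x *m E1>>%MS | x in [set x | cubf B G D x == 0] :\ 0].
  apply/setP => P; apply/setIP/imsetP => [[/imsetP[x]]|[x]]; rewrite !inE.
    by move=> x0 -> /[!in2] // hx; exists x; rewrite // !inE x0.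
  by case/andP=> x0 hx ->; rewrite in2 //; split=> //; apply/imsetP; exists x; rewrite ?inE.
(* Each of the 2q + 2 points has q - 1 representatives, and 0 is one more zero. *)
have card0 : #|[set x | cubf B G D x == 0]| = ((q - 1) * (2 * q + 2) + 1)%N.
  have := cardsD1 0 [set x | cubf B G D x == 0]; rewrite inE cubf0 eqxx => ->.
  rewrite (card_pts f1) ?in_setD1 ?eqxx // -?SE ?hcard.
    by rewrite addnC mulnC.
  move=> x s; rewrite !inE => /andP[x0 /eqP hx] s0 hs.
  by rewrite mulf_neq0 // cubfZ // hx mulr0 /=.
have [u [v [huv hcub]]] := cubic_plane dE card0.
have [e [hB hG hD]] := cubic_factor dE huv hcub; move: hB hG hD.
set al := phi (wedge u v) => hB hG hD.
have al0 : al != 0 by rewrite fmorph_eq0.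
have cubF x : x != 0 -> (cubf B G D x == 0) = (tr (al * x) == 0) || (tr (e * x^-1) == 0).
  move=> x0; have -> : cubf B G D x = tr (al * x) * (nrm x * tr (e * x^-1)).
    have [x1 x2] : phi x != 0 /\ phi (phi x) != 0 by rewrite !fmorph_eq0.
    rewrite /cubf /cub hB hG hD /tr /nrm !(rmorphD, rmorphM, fmorphV) /= !phi3.
    move: x0 x1 x2; move: (phi x) (phi (phi x)) (phi e) (phi (phi e)) (phi al) (phi (phi al)).
    by move=> *; field; apply/and3P.
  by rewrite mulf_eq0 [nrm x * _ == 0]mulf_eq0 nrm_eq0 (negPf x0).
(* Otherwise the cubic vanishes identically, the first splash lies in the second, and q^2 + q + 1 =
   2q + 2, which has no integer solution. *)
have e0 : e != 0.
  apply/eqP => e0; have := card_splash_pts f1.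
  have -> : splash_pts E1 = splash_pts E1 :&: splash_pts E2.
    apply/esym/setIidPl/subsetP => P /imsetP[x]; rewrite inE => x0 ->.
    by rewrite in2 // cubF // e0 mul0r /tr !rmorph0 !addr0 eqxx orbT.
  by rewrite hcard; move: q_gt1; clear; nia.
have UE : splash_pts E1 :&: splash_pts E2 = arc E1 al :|: arc (xrow 0 1 E1) e.
  apply/setP => P; rewrite SE; apply/imsetP/setUP => [[x]|].
    rewrite !inE => /andP[x0]; rewrite cubF // => /orP[h|h] ->; [left|right]; apply/imsetP.
      by exists x; rewrite ?inE ?x0.
    exists x^-1; first by rewrite !inE invr_eq0 x0.
    by rewrite pt_xrow.
  case=> /imsetP[x]; rewrite !inE => /andP[x0 h] ->.
    by exists x; rewrite // !inE x0 cubF // h.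
  exists x^-1; first by rewrite !inE invr_eq0 x0 cubF ?invr_eq0 // invrK h orbT.
  by rewrite -[RHS]pt_xrow ?invr_eq0 // invrK.
have fs : row_free (xrow 0 1 E1) by rewrite /row_free mxrank_xrow.
(* Two arcs of q + 1 points whose union has 2q + 2 points. *)
have dis : [disjoint arc E1 al & arc (xrow 0 1 E1) e].
  rewrite -setI_eq0 -cards_eq0; have := hcard; rewrite UE cardsU !card_arc //.
  by lia.
have [|a' a'0 ha] := arc_transfer det0 al0 hB hG hD (E := E1) (E' := E2); first exact: hE.
(* Swapping the basis of the first splash exchanges [a] with [b], [c] with [d] and [al] with [e]. *)
have [|||||a'' e'0 he] := @arc_transfer b a d c e al _ e0 _ _ _ (xrow 0 1 E1) E2.
- by rewrite -opprB oppr_eq0.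
- by rewrite [phi e * _]mulrC; exact: hG.
- by rewrite [e * _]mulrC; exact: hB.
- by rewrite [e * _]mulrC -hD /D; ring.
- by move=> x; rewrite rv_xrow E1E mulmxA rv_mul; congr (rv _ _ *m _); rewrite /a /b /c /d; ring.
exists al, e; split=> //; exists a', a''; split=> //.
(* Both arcs cannot land in one family of the second splash: two arcs on the same basis meet,
   whereas these are disjoint. *)
case: ha he => [ha|ha] [he|he]; [|by left|by right|].
  by have := arc_meet E2 a' a''; rewrite -ha -he dis.
by have := arc_meet (xrow 0 1 E2) a' a''; rewrite -ha -he dis.
Qed.

(** * Coordinates adapted to an exterior subplane *)

Lemma iterphiM j x y : iter j phi (x * y) = iter j phi x * iter j phi y.
Proof. by elim: j => //= j ->; rewrite rmorphM. Qed.

Lemma iterphi_fix j s : phi s = s -> iter j phi s = s.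
Proof. by move=> hs; elim: j => //= j ->. Qed.

Lemma iterphi_sum (I : finType) j (f : I -> F) :
  iter j phi (\sum_i f i) = \sum_i iter j phi (f i).
Proof. by elim: j => //= j ->; rewrite rmorph_sum. Qed.

Lemma sum_iterphi x : \sum_(j < 3) iter j phi x = tr x.
Proof. by rewrite !big_ord_recl big_ord0 /= addr0 addrA. Qed.

Lemma fixedE s : (s \in GFq q) = (phi s == s).
Proof. by rewrite inE phiE. Qed.

Definition zv x : 'rV[F]_3 := \row_j iter j phi x.

Lemma zv_eq0 x : (zv x == 0) = (x == 0).
Proof.
apply/eqP/eqP => [/rowP/(_ 0)|->]; first by rewrite !mxE.
by apply/rowP => j; rewrite !mxE iterphi_fix ?rmorph0.
Qed.

Lemma zv_scale s x : phi s = s -> zv (s * x) = s *: zv x.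
Proof. by move=> hs; apply/rowP => j; rewrite !mxE iterphiM iterphi_fix. Qed.

Lemma zv_mul x y : zv x *m (zv y)^T = (tr (x * y))%:M.
Proof.
apply/matrixP => i j; rewrite !ord1 !mxE eqxx mulr1n -sum_iterphi.
by apply: eq_bigr => k _; rewrite !mxE iterphiM.
Qed.

Lemma PGlines_eq (m m' P P' : 'M[F]_3) : m \in PGlines F -> m' \in PGlines F ->
    P \in PGpoints F -> P' \in PGpoints F -> P != P' ->
    (P <= m)%MS -> (P' <= m)%MS -> (P <= m')%MS -> (P' <= m')%MS -> m = m'.
Proof.
rewrite !inE => /andP[/eqP rm /eqP em] /andP[/eqP rm' /eqP em'].
move=> /andP[/eqP rP /eqP eP] /andP[/eqP rP' /eqP eP'] neP Pm P'm Pm' P'm'.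
have rC : (1 < \rank (P + P')%MS)%N.
  rewrite ltnNge; apply: contra neP => h.
  have PC : (P == P + P')%MS.
    rewrite -(mxrank_leqif_eq (addsmxSl _ _)) eqn_leq mxrankS ?addsmxSl //=.
    by rewrite rP.
  have P'P : (P' <= P)%MS by rewrite (eqmxP PC) addsmxSr.
  have : (P' == P)%MS by rewrite -(mxrank_leqif_eq P'P) rP rP'.
  by move/genmxP; rewrite eP eP' => ->.
suff h (n : 'M[F]_3) : \rank n = 2%N -> (P <= n)%MS -> (P' <= n)%MS ->
    <<n>>%MS = <<(P + P')%MS>>%MS by rewrite -em -em' !h.
move=> rn Pn P'n; have Cn : (P + P' <= n)%MS by rewrite addsmx_sub Pn.
apply/esym/genmxP; rewrite -(mxrank_leqif_eq Cn) eqn_leq mxrankS //=.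
by rewrite rn.
Qed.

Lemma line_of_PGlines (w : 'cV[F]_3) : w != 0 -> line_of w \in PGlines F.
Proof.
move=> w0; rewrite inE /line_of genmx_id eqxx andbT mxrank_gen mxrank_ker.
by rewrite -mxrank_tr rank_rV -trmx0 (inj_eq trmx_inj) w0.
Qed.

Lemma sub_line_of k (X : 'M[F]_(k, 3)) (w : 'cV[F]_3) : (X <= line_of w)%MS = (X *m w == 0).
Proof. by rewrite genmxE; apply/sub_kermxP/eqP. Qed.

(** Applying [phi] to the equation of the line gives an inclusion, and both sides have rank 2. *)
Lemma conjugate_line_of (A : 'M[F]_3) (w : 'cV[F]_3) : A \in unitmx -> w != 0 ->
  conjugate q A (line_of (invmx A *m w)) = line_of (invmx A *m map_mx phi w).
Proof.
move=> uA w0; rewrite /conjugate.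
have -> : map_mx (fun x => x ^+ q) (line_of (invmx A *m w) *m invmx A) =
    map_mx phi (line_of (invmx A *m w) *m invmx A).
  by apply/matrixP => i j; rewrite !mxE phiE.
set L := line_of _.
have nz (v : 'cV[F]_3) : v != 0 -> invmx A *m v != 0.
  by apply: contraNneq => h; rewrite -[v](mulKVmx uA) h mulmx0.
have h : (map_mx phi (L *m invmx A) *m A <= line_of (invmx A *m map_mx phi w))%MS.
  rewrite sub_line_of -mulmxA mulKVmx // -map_mxM -mulmxA.
  by have := submx_refl L; rewrite {2}/L sub_line_of => /eqP ->; rewrite map_mx0.
have w'0 : map_mx phi w != 0 by rewrite map_mx_eq0.
have := line_of_PGlines (nz _ w'0); have := line_of_PGlines (nz _ w0).
rewrite !inE => /andP[/eqP rL _] /andP[/eqP rL' /eqP <-].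
apply/genmxP; rewrite -(mxrank_leqif_eq h) rL' mxrankMfree ?row_free_unit //.
by rewrite mxrank_map mxrankMfree ?row_free_unit ?unitmx_inv // rL.
Qed.

Lemma ord3P (i : 'I_3) : [\/ i = 0, i = 1 | i = 2].
Proof.
by case: i => [[|[|[|//]]] hi]; [apply: Or31|apply: Or32|apply: Or33]; apply: val_inj.
Qed.

Lemma sum3 (f : 'I_3 -> F) : \sum_i f i = f 0 + f 1 + f 2.
Proof.
rewrite !big_ord_recl big_ord0 addr0 addrA.
by congr (f _ + f _ + f _); apply: val_inj.
Qed.

(** * The Moore matrix of a basis over the subfield, and its inverse *)

Section MooreBasis.

Context (u : 'cV[F]_3).
Context (indep : forall v : 'rV[F]_3, v \is a mxOver (GFq q) -> v *m u = 0 -> v = 0).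

Lemma indep3 c0 c1 c2 : phi c0 = c0 -> phi c1 = c1 -> phi c2 = c2 ->
  c0 * u 0 0 + c1 * u 1 0 + c2 * u 2 0 = 0 -> [/\ c0 = 0, c1 = 0 & c2 = 0].
Proof.
move=> h0 h1 h2 h; pose v : 'rV[F]_3 := \row_k [:: c0; c1; c2]`_k.
have v0 : v = 0.
  apply: indep; last by apply/rowP => j; rewrite ord1 !mxE sum3 !mxE.
  apply/mxOverP => i j; rewrite fixedE mxE; apply/eqP.
  by case: (ord3P j) => ->.
have hv j : v 0 j = 0 by rewrite v0 mxE.
by split; [have := hv 0|have := hv 1|have := hv 2]; rewrite mxE.
Qed.

(** The trace-dual basis consists of cross products divided by the determinant [D], which lies in
    the subfield and is nonzero by independence. *)
Lemma dual_basis : exists n : 'cV[F]_3, forall i k, tr (u i 0 * n k 0) = (i == k)%:R.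
Proof.
pose u0 := u 0 0; pose u1 := u 1 0; pose u2 := u 2 0.
have u20 : u2 != 0.
  apply/eqP => h; have [] := @indep3 0 0 1; rewrite ?rmorph0 ?rmorph1 //.
    by rewrite -/u2 h; ring.
  by move=> _ _ /eqP; rewrite oner_eq0.
have w0 : wedge u1 u2 != 0.
  apply/eqP => h; have hs := wedge_eq0 u20 h.
  have [] := @indep3 0 1 (- (u1 / u2)); rewrite ?rmorph0 ?rmorph1 ?rmorphN ?hs //.
    by rewrite -/u1 -/u2; field.
  by move=> _ /eqP; rewrite oner_eq0.
pose D := tr (phi (wedge u1 u2) * u0).
have D0 : D != 0.
  apply/eqP => /(span_wedge w0)[s [t [hs ht e]]].
  have [] := @indep3 1 (- s) (- t); rewrite ?rmorph1 ?rmorphN ?hs ?ht //.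
    by rewrite -/u0 -/u1 -/u2 e; ring.
  by move=> /eqP; rewrite oner_eq0.
pose w := [:: phi (wedge u1 u2); phi (wedge u2 u0); phi (wedge u0 u1)].
exists (\col_k (D^-1 * w`_k)) => i k.
have DE : phi D^-1 = D^-1 by rewrite fmorphV /D phi_tr.
rewrite mxE mulrCA tr_fixM // mulrC.
suff -> : tr (u i 0 * w`_k) = (i == k)%:R * D by rewrite mulfK.
have D1 : tr (phi (wedge u2 u0) * u1) = D.
  by rewrite /D /tr /wedge !(rmorphM, rmorphB) /= !phi3; ring.
have D2 : tr (phi (wedge u0 u1) * u2) = D.
  by rewrite /D /tr /wedge !(rmorphM, rmorphB) /= !phi3; ring.
case: (ord3P i) => ->; case: (ord3P k) => -> /=; rewrite -/u0 -/u1 -/u2 mulrC;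
  by rewrite ?tr_wedge ?D1 ?D2 ?mul0r ?mul1r.
Qed.

(** [M] has the conjugates of [u] as columns and [N] the conjugates of the dual basis as rows. The
    entries of [zv z *m N] and of [M *m (zv y)^T] are therefore traces; the preimages are [v *m u]
    and the combination of the dual basis with coefficients [w]. *)
Lemma moore_basis : exists (M N : 'M[F]_3),
  [/\ M *m N = 1%:M, (forall j k, N j k = iter j phi (N 0 k)),
      (forall z, zv z *m N \is a mxOver (GFq q)) /\
      (forall v : 'rV[F]_3, v \is a mxOver (GFq q) -> exists z, v = zv z *m N),
      (forall y, M *m (zv y)^T \is a mxOver (GFq q)) /\
      (forall w : 'cV[F]_3, w \is a mxOver (GFq q) -> exists y, w = M *m (zv y)^T) &
      [/\ u = M *m delta_mx 0 0, map_mx phi u = M *m delta_mx 1 0 &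
          map_mx phi (map_mx phi u) = M *m delta_mx 2 0]].
Proof.
have [n hn] := dual_basis.
pose M : 'M[F]_3 := \matrix_(i, j) iter j phi (u i 0).
pose N : 'M[F]_3 := \matrix_(j, k) iter j phi (n k 0).
have MN : M *m N = 1%:M.
  apply/matrixP => i k; rewrite !mxE -hn -sum_iterphi.
  by apply: eq_bigr => j _; rewrite !mxE iterphiM.
have Mcol j : M *m delta_mx j 0 = map_mx (iter j phi) u.
  by rewrite -colE; apply/colP => i; rewrite !mxE.
exists M, N; split=> //; first by move=> j k; rewrite !mxE.
- split=> [z|v /mxOverP hv].
    apply/mxOverP => i k; rewrite fixedE mxE; apply/eqP.
    rewrite (eq_bigr (fun j : 'I_3 => iter j phi (z * n k 0))) ?sum_iterphi ?phi_tr //.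
    by move=> j _; rewrite !mxE iterphiM.
  have hv' i : phi (v 0 i) = v 0 i by apply/eqP; rewrite -fixedE.
  exists ((v *m u) 0 0); rewrite -[LHS]mulmx1 -MN mulmxA; congr (_ *m _); apply/rowP => j.
  rewrite !mxE iterphi_sum; apply: eq_bigr => i _.
  by rewrite mxE iterphiM (iterphi_fix _ (hv' i)).
- split=> [y|w /mxOverP hw].
    apply/mxOverP => i k; rewrite fixedE mxE; apply/eqP.
    rewrite (eq_bigr (fun j : 'I_3 => iter j phi (u i 0 * y))) ?sum_iterphi ?phi_tr //.
    by move=> j _; rewrite !mxE iterphiM.
  have hw' i : phi (w i 0) = w i 0 by apply/eqP; rewrite -fixedE.
  exists (\sum_i n i 0 * w i 0); rewrite -[LHS]mul1mx -MN -mulmxA; congr (_ *m _).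
  apply/colP => j; rewrite !mxE iterphi_sum; apply: eq_bigr => i _.
  by rewrite !mxE iterphiM (iterphi_fix _ (hw' i)).
by split; rewrite Mcol; apply/colP => i; rewrite !mxE.
Qed.

End MooreBasis.

(** * The subplane, its splash and both families in Moore coordinates *)

Section NormalForm.

Context (A M N : 'M[F]_3) (uA : A \in unitmx) (MN : M *m N = 1%:M).
Context (NE : forall j k, N j k = iter j phi (N 0 k)).
Context (zvN : forall z, zv z *m N \is a mxOver (GFq q)).
Context (zvN_onto : forall v : 'rV[F]_3, v \is a mxOver (GFq q) -> exists z, v = zv z *m N).
Context (Mzv : forall y, M *m (zv y)^T \is a mxOver (GFq q)).
Context (Mzv_onto : forall w : 'cV[F]_3, w \is a mxOver (GFq q) -> exists y, w = M *m (zv y)^T).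

Definition coord_point z : 'M[F]_3 := <<zv z *m (N *m A)>>%MS.
(** As [invmx A *m M] is the inverse of [N *m A], this line has the equation [X *m c = 0] in the
    coordinates [X] with respect to [N *m A]. *)
Definition dual_line (c : 'cV[F]_3) : 'M[F]_3 := line_of (invmx A *m (M *m c)).
Definition coord_line y := dual_line (zv y)^T.

Let NM : N *m M = 1%:M := mulmx1C MN.
Let uM : M \in unitmx. Proof. by have [] := mulmx1_unit MN. Qed.
Let uN : N \in unitmx. Proof. by have [] := mulmx1_unit MN. Qed.
Let uT : N *m A \in unitmx. Proof. by rewrite unitmx_mul uN. Qed.

Lemma sub_dual_line k (X : 'M[F]_(k, 3)) c :
  (X *m (N *m A) <= dual_line c)%MS = (X *m c == 0).
Proof.
by rewrite sub_line_of !mulmxA mulmxK // -[X *m N *m M]mulmxA NM mulmx1.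
Qed.

Lemma mxrankT k (X : 'M[F]_(k, 3)) : \rank (X *m (N *m A)) = \rank X.
Proof. by rewrite mxrankMfree ?row_free_unit. Qed.

Lemma dual_line_PGlines c : c != 0 -> dual_line c \in PGlines F.
Proof.
move=> c0; apply: line_of_PGlines; apply: contraNneq c0 => h.
by rewrite -[c](mulKmx uM) -[M *m c](mulKVmx uA) h !mulmx0.
Qed.

Lemma zvT_eq0 y : ((zv y)^T == 0) = (y == 0).
Proof. by rewrite -trmx0 (inj_eq trmx_inj) zv_eq0. Qed.

Lemma coord_incident z y : (coord_point z <= coord_line y)%MS = (tr (z * y) == 0).
Proof.
rewrite genmxE sub_dual_line zv_mul; apply/eqP/eqP => [|->]; last by rewrite raddf0.
by move/matrixP/(_ 0 0); rewrite !mxE eqxx mulr1n.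
Qed.

Lemma coord_point_PGpoints z : z != 0 -> coord_point z \in PGpoints F.
Proof.
by move=> z0; rewrite inE genmx_id eqxx andbT mxrank_gen mxrankT rank_rV zv_eq0 z0.
Qed.

Lemma coord_point_eq z z' : z != 0 -> z' != 0 ->
  (coord_point z == coord_point z') = (wedge z z' == 0).
Proof.
move=> z0 z'0; apply/eqP/eqP => [/genmxP/andP[]|h].
  rewrite submxMfree ?row_free_unit // => /sub_rVP[k /rowP e] _.
  by have := e 0; have := e 1; rewrite !mxE /= => e1 e2; rewrite /wedge e1 {1}e2; ring.
have hs := wedge_eq0 z'0 h; rewrite -[z](divfK z'0) /coord_point zv_scale // -scalemxAl.
by apply/eq_genmx/eqmx_scale; rewrite mulf_neq0 ?invr_neq0.
Qed.

Lemma subplaneE : subplane q A = [set coord_point z | z : F & z != 0].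
Proof.
apply/setP => P; apply/imsetP/imsetP => [[v]|[z]]; rewrite !inE.
  case/andP=> /zvN_onto[z ->] v0 ->; exists z; last by rewrite /coord_point mulmxA.
  by rewrite inE; apply: contraNneq v0 => ->; rewrite (eqP (_ : zv 0 == 0)) ?zv_eq0 ?mul0mx.
move=> z0 ->; exists (zv z *m N); last by rewrite /coord_point mulmxA.
rewrite inE zvN /=; apply: contraNneq z0 => h.
by rewrite -zv_eq0 -[zv z](mulmxK uN) h mul0mx.
Qed.

Lemma extended_linesE :
  extended_lines (subplane q A) = [set coord_line y | y : F & y != 0].
Proof.
apply/setP => m; rewrite inE subplaneE; apply/andP/imsetP => [[hm /card_gt1P[P [P' []]]]|[y]].
  rewrite !inE => /andP[/imsetP[z z0 ->] Pm] /andP[/imsetP[z' z'0 ->] P'm].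
  rewrite !inE in z0 z'0; rewrite coord_point_eq // => zz'.
  have y0 : phi (wedge z z') != 0 by rewrite fmorph_eq0.
  exists (phi (wedge z z')); rewrite ?inE //.
  apply: (PGlines_eq hm _ (coord_point_PGpoints z0) (coord_point_PGpoints z'0)) => //.
  - by apply: dual_line_PGlines; rewrite zvT_eq0.
  - by rewrite coord_point_eq.
  - by rewrite coord_incident mulrC tr_wedge.
  - by rewrite coord_incident mulrC tr_wedge.
rewrite inE => y0 ->; split; first by apply: dual_line_PGlines; rewrite zvT_eq0.
have [z [z' [zz' h h']]] := ker_tr_basis y; have [z0 z'0] := wedge_neq0 zz'.
apply/card_gt1P; exists (coord_point z), (coord_point z').
rewrite !inE !coord_incident ![_ * y]mulrC h h' !eqxx !andbT coord_point_eq // zz'.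
by split=> //; apply/imsetP; [exists z|exists z']; rewrite ?inE.
Qed.

(** A basis of the line X_0 = 0. The minus sign makes [coord_line y] meet it exactly in the vector
    [mv (phi y)]. *)
Let Q : 'M[F]_(2, 3) := \matrix_(i, j) (if i == 0 then (j == 1)%:R else - (j == 2)%:R).
Definition line_basis : 'M[F]_(2, 3) := Q *m (N *m A).
Let l := dual_line (delta_mx 0 0).

Let mulQ x y (c : 'cV[F]_3) : rv x y *m Q *m c = (x * c 1 0 - y * c 2 0)%:M.
Proof.
have Qc : Q *m c = \col_i (if i == 0 then c 1 0 else - c 2 0).
  apply/colP => i; rewrite !mxE sum3 !mxE.
  by case: (i == 0); rewrite /= ?oppr0 ?mul0r ?mul1r ?mulN1r ?addr0 ?add0r.
apply/matrixP => i j; rewrite !ord1 -mulmxA Qc !mxE !big_ord_recl big_ord0 !mxE /=.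
by rewrite mulr1n addr0 mulrN.
Qed.

Lemma row_free_line_basis : row_free line_basis.
Proof.
rewrite /row_free mxrankT -/(row_free Q); apply: inj_row_free => r.
rewrite [r]rvE; set x := r 0 0; set y := r 0 1 => h; apply/eqP; rewrite rv_eq0.
have := mulQ x y (delta_mx 1 0); have := mulQ x y (delta_mx 2 0).
rewrite h !mul0mx => /matrixP/(_ 0 0) h2 /matrixP/(_ 0 0) h1.
move: h1 h2; rewrite !mxE /= !mulr1n !mulr0 !mulr1 subr0 sub0r => <- /eqP.
by rewrite eq_sym oppr_eq0 => ->; rewrite eqxx.
Qed.

Let l_PGlines : l \in PGlines F.
Proof. by apply: dual_line_PGlines; apply/eqP => /colP/(_ 0)/eqP; rewrite !mxE oner_eq0. Qed.

Lemma line_basisE : (line_basis == l)%MS.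
Proof.
have sub : (line_basis <= l)%MS.
  rewrite sub_dual_line -colE; apply/eqP/colP => i; rewrite !mxE /=.
  by case: (i == 0); rewrite ?oppr0.
rewrite -(mxrank_leqif_eq sub); move: l_PGlines; rewrite inE => /andP[/eqP -> _].
exact: row_free_line_basis.
Qed.

Lemma section_coord_line y : y != 0 ->
  <<coord_line y :&: l>>%MS = <<mv (phi y) *m line_basis>>%MS.
Proof.
move=> y0; apply/esym/genmxP.
have sub : (mv (phi y) *m line_basis <= coord_line y :&: l)%MS.
  rewrite sub_capmx mulmxA !sub_dual_line !mulQ !mxE /= !mulr0 subr0 mulrC subrr.
  by rewrite raddf0 eqxx.
rewrite -(mxrank_leqif_eq sub) eqn_leq mxrankS //=.
rewrite (mxrankMfree _ row_free_line_basis) rank_rV mv_eq0 fmorph_eq0 y0 /=.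
(* At rank 2 the two lines would coincide, but the first basis vector of [l] takes the value [phi y]
   on the equation of [coord_line y]. *)
rewrite leqNgt; apply/negP => h.
have lc : (l == coord_line y :&: l)%MS.
  rewrite andbC -(mxrank_leqif_eq (capmxSr _ _)) eqn_leq mxrankS ?capmxSr //=.
  by move: l_PGlines; rewrite inE => /andP[/eqP -> _].
have : (line_basis <= coord_line y)%MS.
  by rewrite (eqmxP line_basisE) (eqmxP lc) capmxSl.
rewrite sub_dual_line => /eqP h'.
have := mulQ 1 0 (zv y)^T; rewrite -mulmxA h' mulmx0 => /matrixP/(_ 0 0)/eqP.
by rewrite !mxE /= mul1r mul0r subr0 mulr1n eq_sym fmorph_eq0 (negPf y0).
Qed.

Let phi_surj x : exists y, phi y = x.
Proof. by exists (phi (phi x)); rewrite phi3. Qed.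

Lemma splash_normal : splash l (subplane q A) = splash_pts line_basis.
Proof.
apply/setP => P; rewrite inE extended_linesE; apply/and3P/imsetP => [[hP Pl]|[x]].
  case/existsP=> m /andP[/imsetP[y]]; rewrite inE => y0 -> Pm.
  exists (phi y); first by rewrite inE fmorph_eq0.
  move: hP; rewrite inE -section_coord_line // => /andP[/eqP rP /eqP <-].
  have sub : (P <= coord_line y :&: l)%MS by rewrite sub_capmx Pm.
  apply/genmxP; rewrite -(mxrank_leqif_eq sub) rP -mxrank_gen section_coord_line //.
  by rewrite mxrank_gen (mxrankMfree _ row_free_line_basis) rank_rV mv_eq0 fmorph_eq0 y0.
have [y <-] := phi_surj x; rewrite inE fmorph_eq0 => y0 ->.
have : (<<mv (phi y) *m line_basis>> <= coord_line y :&: l)%MS.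
  by rewrite -section_coord_line // genmxE.
rewrite sub_capmx => /andP[h1 h2]; split=> //.
  rewrite inE genmx_id eqxx andbT mxrank_gen (mxrankMfree _ row_free_line_basis).
  by rewrite rank_rV mv_eq0 fmorph_eq0 y0.
by apply/existsP; exists (coord_line y); rewrite h1 andbT; apply/imsetP; exists y; rewrite ?inE.
Qed.

Lemma point_family_normal a : a != 0 -> arc line_basis a \in point_family q l A.
Proof.
have [p <-] := phi_surj a; rewrite fmorph_eq0 => p0; apply/imsetP; exists (coord_point p).
  by rewrite subplaneE; apply/imsetP; exists p; rewrite ?inE.
have trE y : (tr (phi p * phi y) == 0) = (tr (p * y) == 0).
  by rewrite -rmorphM tr_phi.
apply/setP => P; apply/imsetP/imsetP => [[x]|[m]]; rewrite inE.
  have [y <-] := phi_surj x; rewrite fmorph_eq0 inE trE => /andP[y0 hy] ->.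
  exists (coord_line y); last by rewrite section_coord_line.
  by rewrite inE coord_incident hy extended_linesE andbT; apply/imsetP; exists y; rewrite ?inE.
rewrite extended_linesE => /andP[/imsetP[y]]; rewrite inE => y0 ->.
rewrite coord_incident => hy ->; exists (phi y); last by rewrite section_coord_line.
by rewrite !inE fmorph_eq0 y0 trE.
Qed.

(** A form without squares, so that its dual conic contains the three coordinate lines, which are
    [l] and its two conjugates. *)
Let conic_mx e : 'M[F]_3 := \matrix_(i, j)
  (if (i == 0) && (j == 1) then phi (phi e) else if (i == 1) && (j == 2) then e
   else if (i == 2) && (j == 0) then phi e else 0).

Definition special_form e : 'M[F]_3 := N^T *m conic_mx e *m N.

Lemma qform_special e c : qform (special_form e) (M *m c) =
  phi (phi e) * c 0 0 * c 1 0 + e * c 1 0 * c 2 0 + phi e * c 2 0 * c 0 0.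
Proof.
rewrite /qform /special_form trmx_mul !mulmxA -(mulmxA c^T) -trmx_mul NM trmx1 mulmx1.
rewrite -(mulmxA (c^T *m _)) NM mulmx1 !mxE sum3 !mxE !sum3 !mxE /=.
by ring.
Qed.

Lemma qform_special_zv e y : y != 0 ->
  qform (special_form e) (M *m (zv y)^T) = nrm y * tr (phi e / phi y).
Proof.
move=> y0; have [y1 y2] : phi y != 0 /\ phi (phi y) != 0 by rewrite !fmorph_eq0.
rewrite qform_special !mxE /= /nrm /tr !rmorphM !fmorphV /= !phi3.
by field; apply/and3P.
Qed.

(** [phi] permutes cyclically both the rows of [N] and the three coefficients. *)
Lemma special_form_fixed e : special_form e \is a mxOver (GFq q).
Proof.
apply/mxOverP => i k; rewrite fixedE /special_form !mxE sum3 !mxE !sum3 !mxE /=.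
rewrite (NE 1 i) (NE 2 i) (NE 1 k) (NE 2 k) /= !(rmorphD, rmorphM, rmorph0) /= !phi3.
by apply/eqP; ring.
Qed.

(** The polar form at [y] is [x |-> tr (k * x)]. If [k] were 0, the value of the form at [y] would
    reduce to [e * phi y * phi (phi y)], which is nonzero. *)
Lemma special_form_nonsingular e : e != 0 -> nonsingular_form q (special_form e).
Proof.
move=> e0; rewrite /nonsingular_form special_form_fixed; apply/forallP => w.
apply/implyP => /andP[/andP[/Mzv_onto[y ->] w0] /eqP hw].
have y0 : y != 0.
  by apply: contraNneq w0 => ->; rewrite (eqP (_ : (zv 0)^T == 0)) ?zvT_eq0 ?mulmx0.
pose k := phi (phi e) * phi y + phi e * phi (phi y).
have k0 : k != 0.
  apply/eqP => k0; move: hw; rewrite qform_special !mxE /= => hw.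
  have : e * phi y * phi (phi y) = 0.
    by rewrite -[RHS]hw -[LHS]addr0 -[0 in LHS](mulr0 y) -k0 /k; ring.
  by move/eqP; rewrite !mulf_eq0 !fmorph_eq0 (negPf e0) (negPf y0).
have [x hx] : exists x, x \notin ker_tr k.
  apply/existsP; rewrite -negb_forall; apply/negP => /forallP h.
  have := card_ker_tr k0; rewrite (_ : ker_tr k = setT); last by apply/setP => x; rewrite h inE.
  by move=> h'; have := ltq2F; rewrite -h' cardsT ltnn.
apply/existsP; exists (M *m (zv x)^T); rewrite Mzv /=.
rewrite -mulmxDr !qform_special !mxE /=; apply: contraNneq hx => h.
rewrite inE /k /tr !(rmorphD, rmorphM) /= !phi3 -subr_eq0; move/eqP: h; rewrite -subr_eq0.
by congr (_ == _); ring.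
Qed.

Context (MS0 : map_mx phi (M *m delta_mx 0 0) = M *m delta_mx 1 0 :> 'cV[F]_3).
Context (MS1 : map_mx phi (M *m delta_mx 1 0) = M *m delta_mx 2 0 :> 'cV[F]_3).

Let Mdelta j : M *m (delta_mx j 0 : 'cV[F]_3) != 0.
Proof.
apply/eqP => h; have : delta_mx j 0 = 0 :> 'cV[F]_3 by rewrite -[LHS](mulKmx uM) h mulmx0.
by move/colP/(_ j)/eqP; rewrite !mxE !eqxx oner_eq0.
Qed.

Lemma special_normal e : e != 0 -> special q l A (special_form e).
Proof.
move=> e0; have ext (j : 'I_3) :
    dual_line (delta_mx j 0) \in extended_dual_conic A (special_form e).
  apply/imsetP; exists (M *m delta_mx j 0) => //.
  by rewrite inE Mdelta qform_special !mxE; case: (ord3P j) => -> /=; apply/eqP; ring.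
have c0 : conjugate q A l = dual_line (delta_mx 1 0).
  by rewrite conjugate_line_of // MS0.
have c1 : conjugate q A (dual_line (delta_mx 1 0)) = dual_line (delta_mx 2 0).
  by rewrite conjugate_line_of // MS1.
by rewrite /special special_form_nonsingular // c0 c1 !ext.
Qed.

(** [coord_line y] lies in the dual conic iff [(phi y)^-1] lies in the plane of [phi e'], and
    inversion swaps the two rows of the basis. *)
Lemma conic_family_normal e : e != 0 -> arc (xrow 0 1 line_basis) e \in conic_family q l A.
Proof.
have [e' <-] := phi_surj e; rewrite fmorph_eq0 => e0; apply/imsetP.
exists (special_form e'); first by rewrite inE special_normal.
have fy y : y != 0 -> (qform (special_form e') (M *m (zv y)^T) == 0) = (tr (phi e' / phi y) == 0).
  by move=> y0; rewrite qform_special_zv // mulf_eq0 nrm_eq0 (negPf y0).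
apply/setP => P; apply/imsetP/imsetP => [[x]|[m /imsetP[w]]]; rewrite inE.
  have [y yE] := phi_surj x^-1; have -> : x = (phi y)^-1 by rewrite yE invrK.
  rewrite invr_eq0 fmorph_eq0 inE => /andP[y0 hy] ->; rewrite pt_xrow ?fmorph_eq0 //.
  exists (coord_line y); last by rewrite section_coord_line.
  apply/imsetP; exists (M *m (zv y)^T) => //; rewrite inE Mzv fy // hy andbT /=.
  by rewrite -zvT_eq0 in y0; apply: contraNneq y0 => h; rewrite -[_^T](mulKmx uM) h mulmx0.
case/and3P=> /Mzv_onto[y ->] w0 hw -> ->.
have y0 : y != 0.
  by apply: contraNneq w0 => ->; rewrite (eqP (_ : (zv 0)^T == 0)) ?zvT_eq0 ?mulmx0.
exists (phi y)^-1; first by rewrite !inE invr_eq0 fmorph_eq0 y0 -fy.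
by rewrite pt_xrow ?fmorph_eq0 // section_coord_line.
Qed.

End NormalForm.

Lemma splash_normal_form (A l : 'M[F]_3) : A \in unitmx -> l \in PGlines F ->
    exterior l (subplane q A) ->
  exists E : 'M[F]_(2, 3), [/\ row_free E, (E == l)%MS,
    splash l (subplane q A) = splash_pts E,
    forall a : F, a != 0 -> arc E a \in point_family q l A &
    forall e : F, e != 0 -> arc (xrow 0 1 E) e \in conic_family q l A].
Proof.
move=> uA hl hext.
have [w w0 lw] : exists2 w : 'cV[F]_3, w != 0 & l *m w = 0.
  have : kermx l^T != 0.
    rewrite -mxrank_eq0 mxrank_ker mxrank_tr; move: hl; rewrite inE => /andP[/eqP -> _].
    by [].
  case/rowV0Pn=> r /sub_kermxP hr r0; exists r^T; first by rewrite -trmx0 (inj_eq trmx_inj).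
  by apply: trmx_inj; rewrite trmx_mul trmxK hr trmx0.
have lE : l = line_of w.
  have sub : (l <= line_of w)%MS by rewrite sub_line_of lw.
  have := line_of_PGlines w0; move: hl.
  rewrite !inE => /andP[/eqP rl /eqP <-] /andP[/eqP rw /eqP <-].
  by apply/genmxP; rewrite -(mxrank_leqif_eq sub) rl rw.
(* The dual coordinates of [l] relative to the subplane; exteriority says that they are independent
   over the subfield. *)
pose u := A *m w.
have indep (v : 'rV[F]_3) : v \is a mxOver (GFq q) -> v *m u = 0 -> v = 0.
  move=> hv vu; apply/eqP; apply: contraT => v0.
  have /forallP/(_ <<v *m A>>%MS)/implyP h := hext.
  have /h : <<v *m A>>%MS \in subplane q A by apply/imsetP; exists v; rewrite // inE hv.
  by rewrite genmxE lE sub_line_of -mulmxA vu eqxx.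
have [M [N [MN NE [zN zN'] [Mz Mz'] [M0 M1 M2]]]] := moore_basis indep.
have lM : l = dual_line A M (delta_mx 0 0) by rewrite /dual_line -M0 /u mulKmx.
exists (line_basis A N); split.
- exact: row_free_line_basis uA MN.
- by rewrite lM; apply: line_basisE.
- by rewrite {1}lM; apply: splash_normal.
- by move=> a a0; rewrite lM; apply: point_family_normal.
- move=> e e0; rewrite lM; apply: conic_family_normal => //.
  + by rewrite -M0.
  + by rewrite -M1.
Qed.

End CubicExtension.

Local Close Scope ring_scope.

Theorem theorem5p3 (F : finFieldType) (q : nat) (l : 'M[F]_3)
    (S1 S2 : {set 'M[F]_3}) (FP1 FC1 FP2 FC2 : {set {set 'M[F]_3}})
    (hq : exists p k : nat, [/\ prime p, 0 < k & q = p ^ k])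
    (hF : #|F| = q ^ 3)
    (hl : l \in PGlines F)
    (hS1 : exterior_splash q l S1)
    (hS2 : exterior_splash q l S2)
    (hfam1 : splash_families q l S1 FP1 FC1)
    (hfam2 : splash_families q l S2 FP2 FC2)
    (hcard : #|S1 :&: S2| = 2 * q + 2) :
  exists b1 b2 : {set 'M[F]_3},
    [/\ subline q l b1, subline q l b2, [disjoint b1 & b2],
        S1 :&: S2 = b1 :|: b2 &
        one_from_each FP1 FC1 b1 b2 /\ one_from_each FP2 FC2 b1 b2].
Proof.
have [phi phiE] := exists_frobenius hq hF.
have q_gt1 : 1 < q.
  by have [p [k [p_pr k0 ->]]] := hq; rewrite -(exp1n k) ltn_exp2r // prime_gt1.
have [A1 [uA1 ext1 S1E -> ->]] := hfam1; have [A2 [uA2 ext2 S2E -> ->]] := hfam2.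
have [E1 [f1 E1l sp1 pf1 cf1]] := splash_normal_form q_gt1 hF phiE uA1 hl ext1.
have [E2 [f2 E2l sp2 pf2 cf2]] := splash_normal_form q_gt1 hF phiE uA2 hl ext2.
rewrite S1E S2E sp1 sp2 in hcard *.
have E12 : (E1 == E2)%MS by apply/eqmxP; apply: eqmx_trans (eqmxP E1l) (eqmx_sym (eqmxP E2l)).
have [a [e [a0 e0 hU dis [a' [e' [a'0 e'0 hfam]]]]]] :=
  two_splashes q_gt1 hF phiE f1 f2 E12 hcard.
have fs : row_free (xrow 0%R 1%R E1) by rewrite /row_free mxrank_xrow.
have sl : (xrow 0%R 1%R E1 == l)%MS.
  by apply/eqmxP; apply: eqmx_trans (mxrank_xrow E1) (eqmxP E1l).
exists (arc phi E1 a), (arc phi (xrow 0%R 1%R E1) e); split=> //.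
- exact: sublineP.
- exact: sublineP.
(* For the first splash [E1] gives the point subline and the swapped basis the conic one; for the
   second splash the roles may be exchanged. *)
split; first by rewrite /one_from_each pf1 ?cf1.
rewrite /one_from_each; case: hfam => -[-> ->]; first by rewrite pf2 ?cf2.
by rewrite orbC cf2 ?pf2.
Qed.
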